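(* Let $m\ge2$ and let $\mu$ be a probability measure on the set of patterns $\mathcal Q_0\cup\{q_1\}\subset\mathcal Q_1$ with finite mean length $\mu(|p|)=\sum_p|p|\,\mu(p)<\infty$. Then the random walk on the linear-activity mother group $\mathfrak M_{m,1}$ with step distribution $\overline\mu$ has zero asymptotic entropy: $H_\infty(\overline\mu)=0$.
   Context: $\mathbb T_m$ is the rooted $m$-ary tree of finite words over $\{0,\dots,m-1\}$; $\operatorname{Aut}(\mathbb T_m)$ acts on the right, and $g=\langle\langle g_0,\dots,g_{m-1}\rangle\rangle\sigma$ with $\sigma\in\operatorname{Sym}(m)$ means $(xw).g=(x.\sigma)(w.g_x)$ for letters $x$ and words $w$; $\sigma\in\operatorname{Sym}(m)$ is identified with $\langle\langle1,\dots,1\rangle\rangle\sigma$. Mother group: $\mathfrak M_{m,r}$ is generated by the elements (for $\sigma,\rho\in\operatorname{Sym}(m)$ with $0.\rho=0$) $\alpha_{-1,\sigma}=\sigma$; $\alpha_{k,\sigma}=\langle\langle\alpha_{k,\sigma},\alpha_{k-1,\sigma},1,\dots,1\rangle\rangle$ ($0\le k\le r$); $\beta_{0,\rho}=\langle\langle\beta_{0,\rho},1,\dots,1\rangle\rangle\rho$; $\beta_{k,\rho}=\langle\langle\beta_{k,\rho},\beta_{k-1,\rho},1,\dots,1\rangle\rangle$ ($1\le k\le r$). Level subgroups: let $\operatorname{Sym}(m)\wr\operatorname{Sym}(m-1)$ be the group of automorphisms of the first two levels of $\mathbb T_m$ fixing $0$ and all its children (so it acts on pairs $xy$ with $x\in\{1,\dots,m-1\}$,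 $y\in\{0,\dots,m-1\}$). For $\sigma$ in this group and a word $w$ over $\{1,\dots,m-1\}$, let $\lambda_{w,\sigma}\in\operatorname{Aut}(\mathbb T_m)$ act as follows: if the first $|w|$ nonzero letters of the input form the word $w$, it replaces the pair consisting of the $(|w|+1)$-st nonzero letter and the letter following it by the image of that pair under $\sigma$; otherwise it does nothing. For $i\ge0$, $\mathfrak L_i=\mathfrak L_{m,i}$ is the (finite) group generated by all $\lambda_{w,\sigma}$ with $|w|=i$; $\mathfrak L_{-1}=\operatorname{Sym}(m)$. One has $\mathfrak L_i\subset\mathfrak M_{m,k}$ for $-1\le i\le k$. Let $\overline{q_i}$ be the uniform probability measure on $\mathfrak L_i$. Patterns: $\mathcal Q_k$ is the semigroup with identity $\emptyset$ generated by letters $q_{-1},q_0,\dots,q_k$ subject to the relations $q_i^2=q_i$; its elements are called patterns, and $|p|$ is the length of the shortest word representing $p$ ($|\emptyset|=0$). The map $q_i\mapsto\overline{q_i}$ extends to a semigroup homomorphism $p\mapsto\overline p$ from $\mathcal Q_k$ to probability measures on $\mathfrak M_{m,k}$ under convolution ($\overline\emptyset=\delta_1$). For a probability measure $\mu$ on patterns, $\overline\mu=\sum_p\mu(p)\overline p$. Entropy: $H(\theta)=\sum_g-\theta(g)\log\theta(g)$ ($0\log0=0$) and $H_\infty(\theta)=\lim_n\frac1nH(\theta^{*n})$. *)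

(* Defs.v *)
From HB Require Import structures.
From mathcomp Require Import all_boot all_order all_algebra perm finmap.
From mathcomp Require Import all_classical all_reals all_analysis.
From mathcomp Require Import generic_quotient.

Set Implicit Arguments.
Unset Strict Implicit.
Unset Printing Implicit Defensive.

Import Order.TTheory GRing.Theory Num.Theory.
Import numFieldNormedType.Exports.

Local Open Scope classical_set_scope.
Local Open Scope ring_scope.
Local Open Scope quotient_scope.

(* The m-ary tree has vertex set [seq 'I_m]; [v] is below [u] when [u] is a
   prefix of [v]. *)
Definition is_tree_aut (m : nat) (f : seq 'I_m -> seq 'I_m) : Prop :=
  [/\ bijective f, forall w, size (f w) = size w
    & forall u v, prefix u v -> prefix (f u) (f v)].

Definition tree_aut (m : nat) : Type :=
  {f : seq 'I_m -> seq 'I_m | is_tree_aut f}.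

HB.instance Definition _ m := gen_eqMixin (tree_aut m).
HB.instance Definition _ m := gen_choiceMixin (tree_aut m).

(* [act g w] is the image w.g of the vertex [w]. *)
Definition act (m : nat) (g : tree_aut m) : seq 'I_m -> seq 'I_m := sval g.

Section TreeAutGroup.
Variable m : nat.
Implicit Types (f g : seq 'I_m -> seq 'I_m) (x y z : tree_aut m).

Lemma act_inj x y : act x =1 act y -> x = y.
Proof.
case: x y => [f fP] [g gP] /= /funext fg; rewrite /act /= in fg.
by subst g; congr exist; exact: Prop_irrelevance.
Qed.

Lemma is_tree_aut_can f g : cancel f g -> cancel g f ->
  (forall w, size (f w) = size w) ->
  (forall u v, prefix u v -> prefix (f u) (f v)) -> is_tree_aut f.
Proof. by move=> fK gK fs fp; split=> //; exists g. Qed.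

Lemma is_tree_aut_id : is_tree_aut (@id (seq 'I_m)).
Proof. exact: (@is_tree_aut_can _ id). Qed.

Lemma is_tree_aut_comp f g :
  is_tree_aut f -> is_tree_aut g -> is_tree_aut (g \o f).
Proof.
move=> [fb fs fp] [gb gs gp]; split; first exact: bij_comp.
- by move=> w /=; rewrite gs fs.
- by move=> u v uv; apply/gp/fp.
Qed.

Lemma is_tree_aut_inv f g :
  is_tree_aut f -> cancel f g -> cancel g f -> is_tree_aut g.
Proof.
move=> [_ fs fp] fK gK.
have gs w : size (g w) = size w by rewrite -[in RHS](gK w) fs.
apply: (is_tree_aut_can gK fK gs) => u v uv.
have /fp : prefix (take (size u) (g v)) (g v) by exact: prefix_take.
rewrite gK => tv; have uE : f (take (size u) (g v)) = u.
  move: tv uv; rewrite !prefixE fs size_take_min gs.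
  move=> /eqP tv /eqP uv; rewrite -tv.
  have /minn_idPl -> : (size u <= size v)%N.
    by rewrite -uv size_take_min geq_minr.
  exact: uv.
by rewrite -{1}uE fK prefix_take.
Qed.

Definition tree_aut_one : tree_aut m := exist _ id is_tree_aut_id.

(* Right action: w.(xy) = (w.x).y *)
Definition tree_aut_mul x y : tree_aut m :=
  exist _ (act y \o act x) (is_tree_aut_comp (svalP x) (svalP y)).

Lemma tree_aut_inv_subproof x :
  {y : tree_aut m | cancel (act x) (act y) /\ cancel (act y) (act x)}.
Proof.
apply: cid; have [[g fK gK] _ _] := svalP x.
by exists (exist _ g (is_tree_aut_inv (svalP x) fK gK)).
Qed.

Definition tree_aut_inv x : tree_aut m := sval (tree_aut_inv_subproof x).

Lemma tree_aut_mulA : associative tree_aut_mul.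
Proof. by move=> x y z; exact: act_inj. Qed.

Lemma tree_aut_mul1 : left_id tree_aut_one tree_aut_mul.
Proof. by move=> x; exact: act_inj. Qed.

Lemma tree_aut_mulr1 : right_id tree_aut_one tree_aut_mul.
Proof. by move=> x; exact: act_inj. Qed.

Lemma tree_aut_mulV : left_inverse tree_aut_one tree_aut_inv tree_aut_mul.
Proof.
move=> x; apply: act_inj => w.
by have [_ gK] := svalP (tree_aut_inv_subproof x); exact: gK.
Qed.

Lemma tree_aut_mulrV : right_inverse tree_aut_one tree_aut_inv tree_aut_mul.
Proof.
move=> x; apply: act_inj => w.
by have [fK _] := svalP (tree_aut_inv_subproof x); exact: fK.
Qed.

HB.instance Definition _ := isGroup.Build (tree_aut m)
  tree_aut_mulA tree_aut_mul1 tree_aut_mulr1 tree_aut_mulV tree_aut_mulrV.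

End TreeAutGroup.

Definition is_subgroup (G : groupType) (H : set G) : Prop :=
  H 1%g /\ forall x y, H x -> H y -> H (x * y^-1)%g.

Definition generated (G : groupType) (S : set G) : set G :=
  smallest (@is_subgroup G) S.

(* Rather than using ['I_m] with [m] a successor, the letters 0 and 1 are
   recognised by their value in [nat]. *)
Definition fixes0 (m : nat) (rho : 'S_m) : Prop :=
  forall x : 'I_m, x = 0%N :> nat -> rho x = x.

Definition rooted_fun (m : nat) (s : 'S_m) (w : seq 'I_m) : seq 'I_m :=
  if w is x :: w' then s x :: w' else [::].

Fixpoint alpha_fun (m : nat) (s : 'S_m) (k : nat) (w : seq 'I_m) : seq 'I_m :=
  if w is x :: w' then
    if x == 0%N :> nat then x :: alpha_fun s k w'
    else if x == 1%N :> nat then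
      x :: (if k is k'.+1 then alpha_fun s k' w' else rooted_fun s w')
    else x :: w'
  else [::].

Fixpoint beta_fun (m : nat) (rho : 'S_m) (k : nat) (w : seq 'I_m) : seq 'I_m :=
  if w is x :: w' then
    if k is k'.+1 then
      if x == 0%N :> nat then x :: beta_fun rho k w'
      else if x == 1%N :> nat then x :: beta_fun rho k' w'
      else x :: w'
    else
      rho x :: (if x == 0%N :> nat then beta_fun rho k w' else w')
  else [::].

(* An element of Sym(m) wr Sym(m-1): the pair xy is sent to
   (x.top)(y.(bot x)), and 0 and its children are fixed. *)
Record two_level (m : nat) := TwoLevel {
  top : 'S_m;
  bot : 'I_m -> 'S_m;
  top_fixes0 : fixes0 top;
  bot_fixes0 : forall x : 'I_m, x = 0%N :> nat -> bot x = 1%g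
}.

(* On a word ending at the (|u|+1)-st nonzero letter only that letter is
   changed, by the action on the first level. *)
Fixpoint lambda_fun (m : nat) (u : seq 'I_m) (s : two_level m)
    (w : seq 'I_m) : seq 'I_m :=
  if w is x :: w' then
    if x == 0%N :> nat then x :: lambda_fun u s w'
    else if u is a :: u' then
      if x == a then x :: lambda_fun u' s w' else x :: w'
    else top s x :: rooted_fun (bot s x) w'
  else [::].

Section Automorphisms.
Variable m : nat.

Lemma rooted_funK (s t : 'S_m) :
  cancel s t -> cancel (rooted_fun s) (rooted_fun t).
Proof. by move=> st [|x w] //=; rewrite st. Qed.

Lemma rooted_aut (s : 'S_m) : is_tree_aut (rooted_fun s).
Proof.
apply: (@is_tree_aut_can _ _ (rooted_fun s^-1%g)).
- exact/rooted_funK/permK.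
- exact/rooted_funK/permKV.
- by case.
- move=> [|x u] [|y v] //; rewrite prefix_cons => /andP[/eqP-> uv].
  by rewrite /= eqxx.
Qed.

Lemma alpha_funK (s t : 'S_m) k :
  cancel s t -> cancel (alpha_fun s k) (alpha_fun t k).
Proof.
move=> st w; elim: w k => [|x w IH] [|k] //=.
- case: ifPn => x0 /=; first by rewrite x0 IH.
  by case: ifPn => x1 /=; rewrite (negPf x0) ?x1 ?rooted_funK// (negPf x1).
- case: ifPn => x0 /=; first by rewrite x0 IH.
  by case: ifPn => x1 /=; rewrite (negPf x0) ?x1 ?IH// (negPf x1).
Qed.

Lemma alpha_aut (s : 'S_m) k : is_tree_aut (alpha_fun s k).
Proof.
apply: (@is_tree_aut_can _ _ (alpha_fun s^-1%g k)).
- exact/alpha_funK/permK.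
- exact/alpha_funK/permKV.
- move=> w; elim: w k => [|x w IH] k //=.
  case: ifP => _ /=; first by rewrite IH.
  by case: ifP => _ //=; case: k => [|k]; rewrite ?IH//; case: (w).
- move=> u v; elim: v u k => [|y v IH] [|x u] k //; first by move=> _; exact: prefix0s.
  rewrite prefix_cons => /andP[/eqP-> uv] /=.
  case: ifP => _ /=; first by rewrite eqxx IH.
  case: ifP => _ /=; last by rewrite eqxx.
  rewrite eqxx /=; case: k => [|k]; last exact: IH.
  by have [_ _] := rooted_aut s; exact.
Qed.

Lemma fixes0V (rho : 'S_m) : fixes0 rho -> fixes0 rho^-1%g.
Proof. by move=> h x x0; rewrite -{1}(h x x0) permK. Qed.

Lemma fixes0_eq0 (rho : 'S_m) (x : 'I_m) :
  fixes0 rho -> (rho x == 0%N :> nat) = (x == 0%N :> nat).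
Proof.
move=> h; apply/idP/idP => /eqP x0; last by rewrite h ?x0.
by have := fixes0V h x0; rewrite permK => {1}->; rewrite x0.
Qed.

Lemma beta_funK (rho rho' : 'S_m) k : fixes0 rho -> cancel rho rho' ->
  cancel (beta_fun rho k) (beta_fun rho' k).
Proof.
move=> h st w; elim: w k => [|x w IH] [|k] //=.
- by rewrite st fixes0_eq0//; case: (x == 0%N :> nat); rewrite ?IH.
- case: ifPn => x0 /=; first by rewrite x0 IH.
  by case: ifPn => x1 /=; rewrite (negPf x0) ?x1 ?IH// (negPf x1).
Qed.

Lemma beta_aut (rho : 'S_m) k : fixes0 rho -> is_tree_aut (beta_fun rho k).
Proof.
move=> h; apply: (@is_tree_aut_can _ _ (beta_fun rho^-1%g k)).
- exact/beta_funK/permK.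
- by apply/beta_funK/permKV; exact: fixes0V.
- move=> w; elim: w k => [|x w IH] [|k] //=.
    by case: ifP; rewrite ?IH.
  by case: ifP => _ /=; rewrite ?IH//; case: ifP => _ //=; rewrite IH.
- move=> u v; elim: v u k => [|y v IH] [|x u] k //.
  - by case: k => [|k] _; exact: prefix0s.
  rewrite prefix_cons => /andP[/eqP-> uv].
  case: k => [|k] /=.
    by rewrite eqxx; case: ifP => //= _; exact: IH.
  case: ifP => _ /=; first by rewrite eqxx (IH u k.+1).
  by case: ifP => _ /=; rewrite eqxx ?IH.
Qed.

Lemma two_levelV_subproof (s : two_level m) (x : 'I_m) :
  x = 0%N :> nat -> (bot s ((top s)^-1%g x))^-1%g = 1%g.
Proof.
move=> x0; rewrite bot_fixes0 ?invg1//.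
by rewrite (fixes0V (@top_fixes0 _ s)).
Qed.

Definition two_levelV (s : two_level m) : two_level m :=
  TwoLevel (fixes0V (@top_fixes0 _ s)) (@two_levelV_subproof s).

Lemma lambda_funK (u : seq 'I_m) (s t : two_level m) :
  cancel (top s) (top t) ->
  (forall x, cancel (bot s x) (bot t (top s x))) ->
  cancel (lambda_fun u s) (lambda_fun u t).
Proof.
move=> st bst w; elim: w u => [|x w IH] u //=.
case: ifPn => x0 /=; first by rewrite x0 IH.
case: u => [|a u] /=.
  rewrite fixes0_eq0; last exact: top_fixes0.
  by rewrite (negPf x0) st rooted_funK.
by case: ifPn => xa /=; rewrite (negPf x0) ?xa ?IH// (negPf xa).
Qed.

Lemma lambda_aut (u : seq 'I_m) (s : two_level m) :
  is_tree_aut (lambda_fun u s).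
Proof.
apply: (@is_tree_aut_can _ _ (lambda_fun u (two_levelV s))).
- by apply: lambda_funK => [|x] y /=; rewrite permK ?permK.
- by apply: lambda_funK => [|x] y /=; rewrite permKV.
- move=> w; elim: w u => [|x w IH] u //=.
  case: ifP => _ /=; first by rewrite IH.
  case: u => [|a u] /=; first by case: (w).
  by case: ifP => _ /=; rewrite ?IH.
- move=> v w; elim: w v u => [|y w IH] [|x v] u //; first by move=> _; exact: prefix0s.
  rewrite prefix_cons => /andP[/eqP-> vw] /=.
  case: ifP => _ /=; first by rewrite eqxx IH.
  case: u => [|a u] /=; last by case: ifP => _ /=; rewrite eqxx ?IH.
  by rewrite eqxx /=; have [_ _] := rooted_aut (bot s y); exact.
Qed.

End Automorphisms.

Definition rooted (m : nat) (s : 'S_m) : tree_aut m :=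
  exist _ (rooted_fun s) (rooted_aut s).

Definition alpha (m k : nat) (s : 'S_m) : tree_aut m :=
  exist _ (alpha_fun s k) (alpha_aut s k).

Definition beta (m k : nat) (rho : 'S_m) (h : fixes0 rho) : tree_aut m :=
  exist _ (beta_fun rho k) (beta_aut k h).

Definition lambda (m : nat) (u : seq 'I_m) (s : two_level m) : tree_aut m :=
  exist _ (lambda_fun u s) (lambda_aut u s).

Definition mother_generators (m r : nat) : set (tree_aut m) :=
  [set g | (exists s, g = rooted s)
        \/ (exists k s, (k <= r)%N /\ g = alpha k s)
        \/ (exists k rho (h : fixes0 rho), (k <= r)%N /\ g = beta k h)].

Arguments mother_generators : clear implicits.

Definition mother_group (m r : nat) : set (tree_aut m) :=
  generated (mother_generators m r).
Arguments mother_group : clear implicits.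

(* [None] stands for the index -1. *)
Definition level_group (m : nat) (i : option nat) : set (tree_aut m) :=
  if i is Some i then
    generated [set g | exists (u : seq 'I_m) (s : two_level m),
      [/\ size u = i, all (fun x : 'I_m => x != 0%N :> nat) u
        & g = lambda u s]]
  else [set g | exists s, g = rooted s].
Arguments level_group : clear implicits.

(* The presented monoid Q_k: words in the letters q_{-1} ([None]), ..., q_k
   modulo the congruence generated by q_i q_i = q_i. *)
Inductive pattern_cong (k : nat) :
    seq (option 'I_k.+1) -> seq (option 'I_k.+1) -> Prop :=
| PatIdem i : pattern_cong [:: i; i] [:: i]
| PatRefl u : pattern_cong u u
| PatSym u v : pattern_cong u v -> pattern_cong v u
| PatTrans u v w : pattern_cong u v -> pattern_cong v w -> pattern_cong u w
| PatCat u u' v v' : pattern_cong u u' -> pattern_cong v v' ->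
    pattern_cong (u ++ v) (u' ++ v').

Definition pattern_rel (k : nat) : rel (seq (option 'I_k.+1)) :=
  fun u v => `[< pattern_cong u v >].

Lemma pattern_rel_refl k : reflexive (@pattern_rel k).
Proof. by move=> u; apply/asboolP; exact: PatRefl. Qed.

Lemma pattern_rel_sym k : symmetric (@pattern_rel k).
Proof. by move=> u v; apply/asboolP/asboolP; exact: PatSym. Qed.

Lemma pattern_rel_trans k : transitive (@pattern_rel k).
Proof.
by move=> v u w /asboolP uv /asboolP vw; apply/asboolP; exact: PatTrans uv vw.
Qed.

Canonical pattern_equiv k := EquivRel (@pattern_rel k)
  (@pattern_rel_refl k) (@pattern_rel_sym k) (@pattern_rel_trans k).

Definition pattern (k : nat) : Type := {eq_quot (@pattern_rel k)}.
HB.instance Definition _ k := Choice.on (pattern k).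
HB.instance Definition _ k := EqQuotient.on (pattern k).

Definition pat (k : nat) (w : seq (option 'I_k.+1)) : pattern k :=
  \pi_(pattern k) w.

Definition pattern_mul (k : nat) (p q : pattern k) : pattern k :=
  pat (repr p ++ repr q).

Lemma pat_eqP k (u v : seq (option 'I_k.+1)) :
  pat u = pat v <-> pattern_cong u v.
Proof.
split=> [/eqP|uv]; first by rewrite /pat eqmodE => /asboolP.
by apply/eqP; rewrite /pat eqmodE; apply/asboolP.
Qed.

Lemma pat_repr k (p : pattern k) : pat (repr p) = p.
Proof. exact: reprK. Qed.

Lemma pattern_mulE k (u v : seq (option 'I_k.+1)) :
  pattern_mul (pat u) (pat v) = pat (u ++ v).
Proof. by apply/pat_eqP/PatCat; apply/pat_eqP/pat_repr. Qed.

Lemma pattern_mulA k : associative (@pattern_mul k).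
Proof.
move=> p q r; rewrite -(pat_repr p) -(pat_repr q) -(pat_repr r).
by rewrite !pattern_mulE catA.
Qed.

Lemma pattern_mul1 k : left_id (pat [::]) (@pattern_mul k).
Proof. by move=> p; rewrite -(pat_repr p) pattern_mulE. Qed.

Lemma pattern_mulr1 k : right_id (pat [::]) (@pattern_mul k).
Proof. by move=> p; rewrite -(pat_repr p) pattern_mulE cats0. Qed.

HB.instance Definition _ k := isMonoid.Build (pattern k)
  (@pattern_mulA k) (@pattern_mul1 k) (@pattern_mulr1 k).

(* The image of Q_j in Q_k. *)
Definition subpatterns (j k : nat) : set (pattern k) :=
  [set p : pattern k | exists w : seq (option 'I_k.+1),
     all (fun i : option 'I_k.+1 => if i is Some i then (i <= j)%N else true) w
     /\ p = pat w].
Arguments subpatterns : clear implicits.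

Lemma pattern_len_subproof k (p : pattern k) :
  exists n, `[< exists w, size w = n /\ pat w = p >].
Proof.
by exists (size (repr p)); apply/asboolP; exists (repr p); rewrite pat_repr.
Qed.

Definition pattern_len (k : nat) (p : pattern k) : nat :=
  ex_minn (pattern_len_subproof p).

(* Discrete measures are identified with their mass functions. *)
Definition is_pmf (R : realType) (T : choiceType) (mu : T -> R) : Prop :=
  (forall x, 0 <= mu x) /\ (\esum_(x in [set: T]) (mu x)%:E = 1)%E.

Definition uniform_on (R : realType) (T : choiceType) (A : set T) (x : T) : R :=
  \1_A x / (#|` fset_set A|)%:R.

Definition mean_length (R : realType) (k : nat) (mu : pattern k -> R) : \bar R :=
  (\esum_(p in [set: pattern k]) (mu p * (pattern_len p)%:R)%:E)%E.

Section Convolution.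
Variables (R : realType) (G : groupType).
Implicit Types theta : G -> R.

Definition point_mass (a x : G) : R := (x == a)%:R.

Definition convolution theta1 theta2 (g : G) : R :=
  fine (\esum_(h in [set: G]) (theta1 h * theta2 (h^-1 * g)%g)%:E).

Definition conv_pow theta (n : nat) : G -> R :=
  iter n (convolution theta) (point_mass 1%g).

Definition entropy theta : \bar R :=
  (\esum_(g in [set: G]) (- (theta g * ln (theta g)))%:E)%E.

(* [h] is the asymptotic entropy H_oo(theta); stated as a convergence, so that
   the existence of the limit is part of the assertion. *)
Definition has_asymptotic_entropy theta (h : \bar R) : Prop :=
  ((n%:R^-1)%:E * entropy (conv_pow theta n))%E @[n --> \oo] --> h.

End Convolution.

(* The value at [p] is computed on a representative of [p]; since the uniform
   measure of a finite group is idempotent under convolution, the result does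
   not depend on the representative and is multiplicative in [p]. *)
Definition pattern_bar (R : realType) (m k : nat) (p : pattern k) :
    tree_aut m -> R :=
  foldr (fun i theta =>
      convolution (uniform_on R (level_group m (omap val i))) theta)
    (point_mass R 1%g) (repr p).

Definition mixture_bar (R : realType) (m k : nat) (mu : pattern k -> R)
    (g : tree_aut m) : R :=
  fine (\esum_(p in [set: pattern k]) (mu p * pattern_bar R p g)%:E).

(* Main.v *)
Require Import Defs.
From HB Require Import structures.
From mathcomp Require Import all_boot all_order all_algebra.
From mathcomp Require Import perm finmap ring lra.
From mathcomp Require Import all_classical all_reals all_analysis.

(* By Gibbs' inequality the entropy of a law is at most a constant times the
   mean length of a program for its elements, up to an additive constant.
   Programs may multiply automorphisms, build one from its sections, and solve
   g = <<g, h_1, ..., h_(m-1)>> s for g.  It thus suffices to bound the mean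
   program length of a product along any word w in q_{-1}, q_0, q_1 by
   eps |w| + C.  Passing to sections replaces w by random words: with respect to
   the blocks of w delimited by q_{-1}, each block is kept with probability 1/m
   and otherwise loses one level.  Summed over the vertices of a level, the
   number of q_1 is preserved, the number of runs of q_{-1} is contracted up to
   a multiple of the number of q_1, and the number of blocks containing q_1
   decreases to an arbitrarily small fraction of |w|, because nearby ones keep
   merging.  A block without q_{-1} is cheap: it fixes the letter 0 and equals
   its own section there, so its other sections, in q_{-1} and q_0 only,
   determine it; and words without q_1 are cheap since their runs contract. *)

Set Implicit Arguments.
Unset Strict Implicit.
Unset Printing Implicit Defensive.
Import Order.TTheory GRing.Theory Num.Theory.
Import numFieldNormedType.Exports.

(** * Words and the words governing their sections *)

(** The obstacle is that sections never lose a [q1], and these may form a positive fraction of [w]: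
    recursion alone gives a cost proportional to their number. The self-similarity of pieces without
    [qm] lowers the price of a [q1] to [eps], against a constant [D], depending on [eps], for each
    block containing [q1]. These blocks must then be thinned out, and they resist merging only when
    far apart; but blocks separated by [K] others number at most about [1/K] of the runs, so they
    can be charged to the runs at rate [D/K]. As runs contract, this charge ends up as one of order
    [m^2 D/K] on each [q1]. Hence the order of choices: [eps], then [D], then [K] with [D/K] small,
    then the number [n] of levels. Additive constants are multiplied by [m] at each level, which is
    harmless because [n] does not depend on [w]. *)

(* The letters q_{-1}, q_0, q_1 of patterns. *)
Inductive letter := qm | q0 | q1.

(* Junk value at [qm], whose sections are trivial. *)
Definition down (i : letter) := if i is q1 then q0 else qm.

Section SectionWords.
Local Open Scope ring_scope.
Variables (R : realFieldType) (m : nat).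
Hypothesis m_ge2 : (2 <= m)%N.
Implicit Types (w u v : seq letter) (F G : seq letter -> R) (a z : bool).

Local Notation M := (m%:R : R).

Lemma M_ge2 : 2 <= M. Proof. by rewrite ler_nat. Qed.
Lemma M_gt0 : 0 < M. Proof. by rewrite ltr0n (leq_trans _ m_ge2). Qed.
Lemma M_neq0 : M != 0. Proof. by rewrite gt_eqF// M_gt0. Qed.

(* Expectation of [F] over the random word governing the section, at a letter
   [x], of a random product along [w]; [z] tells whether [x] is nonzero.  The
   trajectory of [x] stays zero or stays nonzero until the next [qm], which
   makes it uniform; letters met at 0 are kept and letters met elsewhere go one
   level down. *)
Fixpoint section_exp z w F : R :=
  match w with
  | [::] => F [::]
  | qm :: w' => (section_exp false w' F + (M - 1) * section_exp true w' F) / M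
  | i :: w' => section_exp z w' (fun u => F ((if z then down i else i) :: u))
  end.

(* Sum over the [m] starting letters. *)
Definition section_sum w F := section_exp false w F + (M - 1) * section_exp true w F.

Lemma section_exp_qm z w F : M * section_exp z (qm :: w) F = section_sum w F.
Proof. by rewrite /= mulrC divfK// M_neq0. Qed.

Lemma section_exp_le z w F G :
  (forall u, F u <= G u) -> section_exp z w F <= section_exp z w G.
Proof.
elim: w z F G => [|[] w IH] z F G FG /=; [exact: FG| |by apply: IH|by apply: IH].
rewrite ler_pM2r ?invr_gt0 ?M_gt0// lerD ?IH//.
by rewrite ler_pM2l ?IH// subr_gt0 (lt_le_trans _ M_ge2)// ltr1n.
Qed.

Lemma eq_section_exp z w F G : F =1 G -> section_exp z w F = section_exp z w G.
Proof. by move=> FG; apply/eqP; rewrite eq_le !section_exp_le// => u; rewrite FG. Qed.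

Lemma section_exp_lin z w (a b : R) F G :
  section_exp z w (fun u => a * F u + b * G u) =
  a * section_exp z w F + b * section_exp z w G.
Proof.
elim: w z F G => [|[] w IH] z F G //=.
rewrite !IH; field; exact: M_neq0.
Qed.

Lemma section_exp_cst z w (b : R) : section_exp z w (fun=> b) = b.
Proof.
elim: w z => [|[] w IH] z //=.
rewrite !IH; field; exact: M_neq0.
Qed.

Lemma section_exp_addc z w F (b : R) :
  section_exp z w (fun u => b + F u) = b + section_exp z w F.
Proof.
transitivity (section_exp z w (fun u => 1 * b + 1 * F u)).
  by apply: eq_section_exp => u; rewrite !mul1r.
by rewrite (section_exp_lin z w 1 1 (fun=> b) F) section_exp_cst !mul1r.
Qed.

Lemma section_sum_le w F G : (forall u, F u <= G u) -> section_sum w F <= section_sum w G.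
Proof.
move=> FG; rewrite lerD ?section_exp_le// ler_pM2l ?section_exp_le//.
by rewrite subr_gt0 (lt_le_trans _ M_ge2)// ltr1n.
Qed.

Lemma section_sum_lin w (a b : R) F G :
  section_sum w (fun u => a * F u + b * G u) = a * section_sum w F + b * section_sum w G.
Proof. by rewrite /section_sum !section_exp_lin; ring. Qed.

Lemma section_sum_cst w (b : R) : section_sum w (fun=> b) = M * b.
Proof. by rewrite /section_sum !section_exp_cst; ring. Qed.

Fixpoint ones w : R :=
  if w is i :: w' then (if i is q1 then 1 else 0) + ones w' else 0.

(* Occurrences of [q1] before the first [qm]. *)
Fixpoint ones1 w : R :=
  match w with [::] => 0 | qm :: _ => 0 | q0 :: w' => ones1 w' | q1 :: w' => 1 + ones1 w' end.

Lemma ones_ge0 w : 0 <= ones w.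
Proof. by elim: w => [|[] w IH] //=; rewrite addr_ge0. Qed.

(** On average exactly one of the [m] trajectories is at 0 when a given [q1] is met, and only that
    one keeps it. *)
Lemma section_sum_ones w : section_sum w ones = ones w.
Proof.
(* Before the first [qm] the trajectory is not yet uniform: started at 0 it keeps all [ones1 w]
   letters [q1], started elsewhere none. Each later one is kept with probability [1/m]. *)
suff H : M * section_exp false w ones = ones w + (M - 1) * ones1 w /\
         M * section_exp true w ones = ones w - ones1 w.
  apply: (mulfI M_neq0); rewrite /section_sum mulrDr mulrCA.
  by case: H => -> ->; ring.
elim: w => [|i w [IH0 IH1]]; first by split=> /=; ring.
case: i.
- have E : section_sum w ones = ones w.
    by apply: (mulfI M_neq0); rewrite /section_sum mulrDr mulrCA IH0 IH1; ring.
  by rewrite !section_exp_qm E /=; split; ring.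
- by rewrite /= !section_exp_addc !add0r IH0 IH1.
- by rewrite /= !section_exp_addc mulrDr !add0r IH0 IH1; split; ring.
Qed.

(* Number of maximal runs of [qm]; [a] tells whether the letter preceding [w]
   is [qm]. *)
Fixpoint runs a w : R :=
  match w with
  | [::] => 0
  | qm :: w' => (~~ a)%:R + runs true w'
  | _ :: w' => runs false w'
  end.

Lemma runs_ge0 a w : 0 <= runs a w.
Proof. by elim: w a => [|[] w IH] a //=; rewrite addr_ge0// ler0n. Qed.

Lemma runs_tf w : runs true w <= runs false w.
Proof. by case: w => [|[] w] //=; rewrite lerD2r. Qed.

Lemma runs_ft w : runs false w <= 1 + runs true w.
Proof. by case: w => [|[] w] //=; rewrite ?add0r ?lerDr// addr0. Qed.

Lemma section_sum_qm w F : section_sum (qm :: w) F = section_sum w F.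
Proof. by rewrite /section_sum /=; field; exact: M_neq0. Qed.

(** The pointwise bound [runs_ft] would give [M]. One is saved because a trajectory at 0 keeps the
    first letter other than [qm], so its section ignores the flag. *)
Lemma section_sum_runs_ft w :
  section_sum w (runs false) <= section_sum w (runs true) + (M - 1).
Proof.
have := M_ge2; elim: w => [|i w IH] M2; first by rewrite /section_sum /=; lra.
case: i.
- by rewrite !section_sum_qm IH.
- rewrite /section_sum /= !section_exp_addc /= !add0r; nra.
- rewrite /section_sum /=; nra.
Qed.

(* The factor [1 - 1/m] appears because a run survives only when a [q0]-block
   seen at a nonzero letter follows one seen at 0; blocks with [q1] create at
   most [m] new runs per [q1]. *)
Lemma section_sum_runs w :
  section_sum w (runs false) <= (1 - M^-1) * runs false w + M * ones w + M *+ 2.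
Proof.
set q := 1 - M^-1.
have q0' : 0 <= q by rewrite subr_ge0 invf_le1 ?M_gt0// ler1n (leq_trans _ m_ge2).
have q1' : q <= 1 by rewrite lerBlDr lerDl invr_ge0 ltW// M_gt0.
have M2 := M_ge2.
have qE : M * q = M - 1 by rewrite mulrBr mulr1 mulfV ?M_neq0.
(* The first bound is for a trajectory made uniform by [qm]. Inside a block, a trajectory at 0 has
   just kept a letter other than [qm], so only the flag [false] occurs; at a nonzero letter [q0]
   turns into [qm] and [q1] into [q0], so both flags occur. *)
suff [H1 _] : section_sum w (runs true) <= q * runs true w + M * ones w + 1 /\
  [/\ M * section_exp false w (runs false) <=
        q * runs false w + M * ones w + 1 + (M - 1) - q,
      M * section_exp true w (runs true) <= q * runs false w + M * ones w + 1 - q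
    & M * section_exp true w (runs false) <= q * runs false w + M * ones w + 1 - q + M].
  have := section_sum_runs_ft w; have := runs_tf w; have := runs_ge0 true w.
  move=> ? ? ?; have : q * runs true w <= q * runs false w by rewrite ler_wpM2l.
  by lra.
elim: w => [|i w [IHs [IH0 IHt IHf]]];
  first by split; last split; rewrite /section_sum /=; lra.
have := section_sum_runs_ft w.
case: i => ft.
- rewrite section_sum_qm !section_exp_qm /= ?add0r.
  split; first by [].
  by split; lra.
- rewrite /section_sum /= !section_exp_addc /= !add0r; split; last by split; lra.
  rewrite -(@ler_pM2l _ M) ?M_gt0// mulrDr mulrCA.
  nra.
- rewrite /section_sum /=; split; last by split; lra.
  have M1 : 0 <= M - 1 by lra.
  rewrite -(@ler_pM2l _ M) ?M_gt0// mulrDr mulrCA.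
  by have := ler_wpM2l M1 IHf; lra.
Qed.

(* A block is a maximal factor without [qm].  Number of blocks containing [q1],
   where [a] tells whether the current block is already counted. *)
Fixpoint blocks a w : R :=
  match w with
  | [::] => 0
  | qm :: w' => blocks false w'
  | q0 :: w' => blocks a w'
  | q1 :: w' => (~~ a)%:R + blocks true w'
  end.

Lemma blocks_ge0 a w : 0 <= blocks a w.
Proof. by elim: w a => [|[] w IH] a //=; rewrite addr_ge0// ler0n. Qed.

Lemma blocks_tf w : blocks true w <= blocks false w.
Proof. by elim: w => [|[] w IH] //=; rewrite lerD2r. Qed.

(* [M^-1] to the number of nonempty blocks up to the next one containing [q1],
   the current block counting only if [fresh]; 0 if there is none. *)
Fixpoint pending (fresh : bool) w : R :=
  match w with
  | [::] => 0
  | qm :: w' => pending true w'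
  | q0 :: w' => (if fresh then M^-1 else 1) * pending false w'
  | q1 :: w' => if fresh then M^-1 else 1
  end.

Fixpoint pending_after w : R :=
  match w with
  | [::] => 0
  | qm :: w' => pending true w'
  | _ :: w' => pending_after w'
  end.

(* Two consecutive blocks containing [q1] with [k] nonempty blocks between them
   are merged by the section when all of them are met at 0; summed over the
   starting letters this has weight [m^-(k+1)]. *)
Fixpoint merges a w : R :=
  match w with
  | [::] => 0
  | qm :: w' => (if a then pending true w' else 0) + merges false w'
  | q0 :: w' => merges a w'
  | q1 :: w' => merges true w'
  end.

(** Flagging the current block as counted gains 1 if it still contains a [q1], and otherwise the
    weight of a merge with the next block that does; [pending false w] is that gain in both
    cases. *)
Lemma blocks_merges w :
  blocks true w - merges true w = blocks false w - merges false w - pending false w.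
Proof. by elim: w => [|[] w IH] /=; lra. Qed.

Lemma section_sum_blocks_merges w :
  section_sum w (blocks false) <= blocks false w - merges false w.
Proof.
(* The sums over all letters serve after a [qm], the other bounds inside a block whose letter is
   known. There the current block weighs [M] (at 0) or 0 (elsewhere) instead of 1, both in the count
   and in the merge that it starts, whence the corrections by [pending false w] and
   [pending_after w]. *)
suff [] : [/\ section_sum w (blocks false) <= blocks false w - merges false w,
     section_sum w (blocks true) <= blocks false w - merges false w - M * pending true w,
     M * section_exp false w (blocks true) <=
       blocks true w - merges true w - (M - 1) * pending_after w,
     M * section_exp false w (blocks false) <=
       blocks false w - merges false w + (M - 1) * (pending false w - pending_after w)
   & M * section_exp true w (blocks false) <=
       blocks false w - merges false w - (pending false w - pending_after w)] by [].
have M2 := M_ge2; have M1 : 0 <= M - 1 by lra.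
have MV : M * M^-1 = 1 by rewrite mulfV// M_neq0.
elim: w => [|i w [Sf St Pt Pf Rf]]; first by rewrite /section_sum /=; split; lra.
have bm := blocks_merges w; have bmM := congr1 ( *%R M) bm.
have Rtf : section_exp true w (blocks true) <= section_exp true w (blocks false).
  by apply: section_exp_le => u; exact: blocks_tf.
have Rf1 := ler_wpM2l M1 Rf.
have M0 := M_gt0; have Rt1 := ler_wpM2l M1 (ler_wpM2l (ltW M0) Rtf).
have P0 a : section_exp false (q0 :: w) (blocks a) = section_exp false w (blocks a) by [].
have R0 a : section_exp true (q0 :: w) (blocks a) = section_exp true w (blocks false) by [].
have P1 a : section_exp false (q1 :: w) (blocks a) =
    (~~ a)%:R + section_exp false w (blocks true) by rewrite -section_exp_addc.
have R1 a : section_exp true (q1 :: w) (blocks a) = section_exp true w (blocks a) by [].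
case: i.
- by rewrite !section_sum_qm !section_exp_qm /=; split; lra.
- rewrite /section_sum !P0 !R0 /= mulrA MV !mul1r.
  by split=> //; rewrite -(@ler_pM2l _ M)// mulrDr mulrCA; lra.
- rewrite /section_sum !P1 !R1 /= MV !add0r.
  split; rewrite -?[_ + (M - 1) * _ <= _](@ler_pM2l _ M)// ?mulrDr ?(mulrCA M); lra.
Qed.

(** Consecutive blocks with [q1] that are close merge with weight at least [M^-1 ^+ K]; the bound
    [kb], linear in the separation and vanishing at [K], covers all separations. Being linear it can
    be summed, and the separations add up to at most the number of runs. The last block has no
    successor, whence [- 1]. *)
Lemma merges_ge (K : nat) w : (0 < K)%N ->
  M^-1 ^+ K * (blocks false w - 1 - runs false w / K%:R) <= merges false w.
Proof.
move=> K0.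
set k := M^-1 ^+ K; set b := k / K%:R.
have MV0 : 0 < M^-1 by rewrite invr_gt0 M_gt0.
have MV1 : M^-1 <= 1 by rewrite invf_le1 ?M_gt0// ler1n (leq_trans _ m_ge2).
have k_ge0 : 0 <= k by rewrite exprn_ge0// ltW.
have b_ge0 : 0 <= b by rewrite divr_ge0.
have kb j : k - b * j%:R <= M^-1 ^+ j.
  have [jK|Kj] := leqP j K.
    apply: (@le_trans _ _ k); first by rewrite lerBlDr lerDl mulr_ge0.
    by rewrite ler_wiXn2l// ltW.
  apply: (@le_trans _ _ 0); last by rewrite exprn_ge0// ltW.
  by rewrite subr_le0 /b -mulrA ler_peMr// mulrC ler_pdivlMr ?ltr0n// mul1r ler_nat ltnW.
(* [j] is the number of nonempty blocks passed since the last one with [q1]; in the fourth bound the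
   current block is itself nonempty and not yet included in [j]. *)
suff [H _ _ _] : [/\ k * (blocks false w - 1) - b * runs false w <= merges false w,
   k * blocks true w - b * runs false w <= merges true w,
   forall j, k * blocks false w - b * (j%:R + 1 + runs true w) <=
     M^-1 ^+ j * pending true w + merges false w
 & forall j, k * blocks false w - b * (j%:R + 1 + runs false w) <=
     M^-1 ^+ j.+1 * pending false w + merges false w].
  by apply: le_trans H; rewrite /b mulrBr mulrA mulrAC.
elim: w => [|i w [IH0 IHt IHf IHz]].
  by split=> [||j|j] /=; rewrite !(mulr0, addr0); try have := mulr_ge0 b_ge0 (ler0n R j.+1);
    rewrite -?natr1; lra.
have ft := runs_ft w; have := runs_ge0 true w.
case: i => r0; rewrite /= ?add0r.
- have := ler_wpM2l b_ge0 ft; rewrite mulrDr mulr1 => ft'.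
  split=> [||j|j].
  + lra.
  + by have := IHf 0; rewrite expr0 mul1r; lra.
  + exact: IHf.
  + by have := IHf j.+1; rewrite -natr1; lra.
- split=> [||j|j]; rewrite ?mul1r//.
  by rewrite mulrA -exprSr; exact: IHz.
- have H j : k * (1 + blocks true w) - b * (j%:R + 1 + runs false w) <=
    M^-1 ^+ j.+1 + merges true w.
    by have := kb j.+1; rewrite -natr1; lra.
  split=> [||j|j]; rewrite ?mulr1 -?exprSr//.
  lra.
Qed.

Lemma section_sum_blocks (K : nat) w : (0 < K)%N ->
  section_sum w (blocks false) <=
  (1 - M^-1 ^+ K) * blocks false w + M^-1 ^+ K / K%:R * runs false w + 1.
Proof.
move=> K0; have := section_sum_blocks_merges w; have := merges_ge w K0.
have : M^-1 ^+ K <= 1.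
  by apply: exprn_ile1; rewrite ?invr_ge0 ?ler0n// invf_le1 ?M_gt0// ler1n (leq_trans _ m_ge2).
set k := _ ^+ K; rewrite mulrBr mulrA => k1 H1 H2.
have -> : k / K%:R * runs false w = k * runs false w / K%:R by rewrite mulrAC.
lra.
Qed.

End SectionWords.

Definition is_qm i := if i is qm then true else false.
Definition is_q1 i := if i is q1 then true else false.

Section Counting.
Local Open Scope classical_set_scope.
Local Open Scope ring_scope.
Variable R : realFieldType.
Implicit Types (u v w b : seq letter).

Lemma runs_cat1 a u w : @runs R a (u ++ q1 :: w) = runs R a u + runs R false w.
Proof. by elim: u a => [|[] u IH] a //=; rewrite ?add0r// IH addrA. Qed.

Lemma ones_cat u v : @ones R (u ++ v) = ones R u + ones R v.
Proof. by elim: u => [|i u IH] /=; rewrite ?add0r// IH addrA. Qed.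

Lemma ones_noq1 u : all (predC is_q1) u -> @ones R u = 0.
Proof. by elim: u => [|[] u IH] //= /IH ->; rewrite add0r. Qed.

(** Going down, the letters [q1] become [q0], the only separators of the runs. *)
Lemma runs_down a b : all (predC is_qm) b ->
  @runs R a (map down b) <= ones R b + (~~ a)%:R.
Proof.
elim: b a => [|[] b IH] a //=.
- by move=> /(IH true); rewrite add0r addr0 addrC => h; rewrite lerD2r.
- move=> /(IH false) /= h; have := ler0n R (~~ a); lra.
Qed.

Lemma ones_down b : all (predC is_qm) b -> @ones R (map down b) = 0.
Proof. by elim: b => [|[] b IH] //= /IH ->; rewrite add0r. Qed.

Lemma counts_le_size w :
  [/\ @runs R false w <= (size w)%:R, @ones R w <= (size w)%:R
    & @blocks R false w <= (size w)%:R].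
Proof.
suff [H1 H2 H3] : [/\ forall a, @runs R a w <= (size w)%:R, @ones R w <= (size w)%:R
    & forall a, @blocks R a w <= (size w)%:R] by [].
elim: w => [|i w [H1 H2 H3]] //=; rewrite -natr1; split=> [a||a]; case: i.
- have := H1 true; have : (~~ a)%:R <= 1 :> R by case: a => //=.
  lra.
- by have := H1 false; lra.
- by have := H1 false; lra.
- by lra.
- by lra.
- by lra.
- by have := H3 false; lra.
- by have := H3 a; lra.
- have := H3 true; have : (~~ a)%:R <= 1 :> R by case: a => //=.
  lra.
Qed.

End Counting.

Lemma expr_small (R : realType) (x e : R) :
  (0 <= x -> x < 1 -> 0 < e -> exists n, x ^+ n < e)%R.
Proof.
move=> x0 x1 e0.
have := @cvg_expr R x; rewrite ger0_norm// => /(_ x1)/cvgr0Pnorm_lt/(_ _ e0)[n _ H].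
exists n; have := H n (leqnn n); rewrite /= ger0_norm// exprn_ge0//.
Qed.

(** * Sublinear costs on words *)

Section Cost.
Local Open Scope classical_set_scope.
Local Open Scope ring_scope.
Variables (R : realType) (m : nat).
Hypothesis m_ge2 : (2 <= m)%N.
Variables (L : seq letter -> R) (C : R).
Implicit Types (u v w : seq letter).
Local Notation M := (m%:R : R).
Local Notation runs := (@runs R).
Local Notation ones := (@ones R).
Local Notation blocks := (@blocks R).

Hypothesis C_ge0 : 0 <= C.
Hypothesis L_nil : L [::] <= C.
Hypothesis L_letter : forall i, L [:: i] <= C.
Hypothesis L_cat : forall u v, L (u ++ v) <= L u + L v + C.
Hypothesis L_idem : forall i w, L (i :: i :: w) = L (i :: w).
Hypothesis L_sec : forall w, L w <= C + section_sum m w L.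
Hypothesis L_fix : forall w, all (predC is_qm) w ->
  L w <= C + (M - 1) * L (map down w).

(** Repetitions collapse by [L_idem]. In what remains every [q0], except possibly the first letter,
    follows a [qm] or a [q1], so at most [2 * runs false w + 2 * ones w + 1] letters are left, each
    costing [C] and another [C] for the concatenation. *)
Lemma cost_base w : L w <= (4 * C) * runs false w + (4 * C) * ones w + 4 * C.
Proof.
have C0 := C_ge0; have L0 := L_nil.
suff : L w <= (2 * C) * (2 * runs false w + 2 * ones w +
    (if w is q0 :: _ then 1 else 0) + 1).
  by case: w => [|[] w] /=; lra.
elim: w => [|i [|j w] IH]; first by rewrite /=; lra.
  by have := L_letter i; case: i => /=; lra.
have Ci : L [:: i, j & w] <= L (j :: w) + 2 * C.
  by have := L_cat [:: i] (j :: w); have := L_letter i; rewrite /=; lra.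
have o0 := ones_ge0 R w; have r0 := runs_ge0 R true w; have := runs_tf R w => rt.
case: i j IH Ci => [] [] //= IH Ci; rewrite ?L_idem; nra.
Qed.

(** One level of sections by [L_sec]: the runs created by [q1]s feed [b], and the blocks too sparse
    to merge feed [a]. *)
Lemma cost_step (K : nat) (a b d e : R) : (0 < K)%N ->
  0 <= a -> 0 <= d ->
  (forall w, L w <= a * runs false w + b * ones w + d * blocks false w + e) ->
  exists e', forall w,
   L w <= (a * (1 - M^-1) + d * (M^-1 ^+ K / K%:R)) * runs false w +
     (b + M * a) * ones w + d * (1 - M^-1 ^+ K) * blocks false w + e'.
Proof.
have C0 := C_ge0.
move=> K0 a0 d0 H.
exists (C + a * (M *+ 2) + d + M * e) => w.
apply: (le_trans (L_sec w)).
have : section_sum m w L <= a * section_sum m w (runs false) + b * section_sum m w ones +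
    d * section_sum m w (blocks false) + M * e.
  apply: (@le_trans _ _ (section_sum m w (fun u =>
     1 * (a * runs false u + b * ones u) + 1 * (d * blocks false u + 1 * e)))).
    by apply: section_sum_le => // u; have := H u; lra.
  rewrite (section_sum_lin m_ge2 w 1 1 (fun u => a * runs false u + b * ones u)
    (fun u => d * blocks false u + 1 * e)).
  rewrite (section_sum_lin m_ge2 w a b (runs false) ones).
  by rewrite (section_sum_lin m_ge2 w d 1 (blocks false) (fun=> e)) section_sum_cst//; lra.
have := ler_wpM2l a0 (section_sum_runs R m_ge2 w).
have := ler_wpM2l d0 (section_sum_blocks R m_ge2 w K0).
rewrite section_sum_ones//.
set k := M^-1 ^+ K; lra.
Qed.

(** With [d = 0] each level contracts the coefficient of the runs by [1 - M^-1]. The growth of [b]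
    is harmless, as the bound is meant for words without [q1]. *)
Lemma cost_noq1 (eps : R) : 0 < eps ->
  exists b e, forall w, L w <= eps * runs false w + b * ones w + e.
Proof.
have C0 := C_ge0; move=> eps0.
set q := 1 - M^-1.
have M0 := M_gt0 R m_ge2.
have q_ge0 : 0 <= q by rewrite subr_ge0 invf_le1// ler1n (leq_trans _ m_ge2).
have q_lt1 : q < 1 by rewrite ltrBlDr ltrDl invr_gt0.
suff H n : exists b e, forall w, L w <= 4 * C * q ^+ n * runs false w + b * ones w + e.
  have [n nH] : exists n, q ^+ n < eps / (4 * C + 1).
    by apply: expr_small => //; rewrite divr_gt0//; lra.
  have [b [e bH]] := H n; exists b, e => w; apply: (le_trans (bH w)).
  rewrite !lerD2r ler_wpM2r ?runs_ge0//.
  have C41 : 0 < 4 * C + 1 by lra.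
  move: nH; rewrite ltr_pdivlMr// => /ltW; apply: le_trans.
  by have := exprn_ge0 n q_ge0; lra.
elim: n => [|n [b [e IH]]].
  by exists (4 * C), (4 * C) => w; rewrite expr0 mulr1 cost_base.
have [||||e' H] := @cost_step 1 (4 * C * q ^+ n) b 0 e.
- by [].
- by rewrite mulr_ge0 ?exprn_ge0//; lra.
- by [].
- by move=> w; rewrite mul0r addr0.
exists (b + M * (4 * C * q ^+ n)), e' => w.
by have := H w; rewrite (exprSr q) -/q !mul0r !addr0; lra.
Qed.

(* [w] splits into pieces without [q1] and pieces without [qm], with at most
   [blocks false w] pieces of the second kind; both kinds are cheap. *)
Lemma cost_pieces (eps : R) : 0 < eps -> exists2 D, 0 <= D & forall w,
  L w <= eps * runs false w + eps * ones w + D * blocks false w + D.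
Proof.
have C0 := C_ge0; move=> eps0; have M2 := M_ge2 R m_ge2.
have M1 : 0 < M - 1 by lra.
have [b1 [e1 H1]] := cost_noq1 eps0.
(* [L_fix] brings a factor [M - 1], and by [runs_down] the runs of the lowered piece are paid for by
   its [q1]s. *)
have [|b2 [e2 H2]] := @cost_noq1 (eps / (M - 1)); first by rewrite divr_gt0.
pose D := C + `|e1| + C + (M - 1) * (eps / (M - 1) + `|e2|).
have e0 : 0 <= eps / (M - 1) by exact: divr_ge0 (ltW eps0) (ltW M1).
have X0 : 0 <= (M - 1) * (eps / (M - 1) + `|e2|).
  exact: mulr_ge0 (ltW M1) (addr_ge0 e0 (normr_ge0 _)).
have N0 := normr_ge0 e1.
have D0 : 0 <= D by rewrite /D; lra.
have Hu u : all (predC is_q1) u -> L u + C <= eps * runs false u + D.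
  move=> hu; have := H1 u; rewrite ones_noq1// mulr0 addr0 => h.
  by have := ler_norm e1; rewrite /D; lra.
have Hb b : all (predC is_qm) b -> L b + C <= eps * ones b + D.
  move=> hb; have := L_fix hb; have := H2 (map down b).
  rewrite ones_down// mulr0 addr0 => /(ler_wpM2l (ltW M1)).
  have := runs_down R false hb; rewrite /=.
  move=> /(ler_wpM2l e0) /(ler_wpM2l (ltW M1)).
  have := ler_wpM2l (ltW M1) (ler_norm e2).
  have -> : (M - 1) * (eps / (M - 1) * (ones b + 1)) =
      eps * ones b + (M - 1) * (eps / (M - 1)).
    by field; lra.
  by have := normr_ge0 e1; rewrite /D; lra.
exists (D *+ 2); first by rewrite mulrn_wge0.
(* [u] and [b] are the piece being read. A piece without [qm] opens at a [q1] and ends at the next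
   [qm], so each block with [q1] accounts for two pieces, its own and the one after it, in addition
   to the initial piece. *)
suff H w : (forall u, all (predC is_q1) u -> L (u ++ w) <=
      eps * (runs false (u ++ w) + ones w) + D * (blocks false w *+ 2 + 1)) /\
    (forall b, all (predC is_qm) b -> L (b ++ w) <=
      eps * (runs false w + ones (b ++ w)) + D * (blocks true w *+ 2 + 2)).
  by move=> w; have [+ _] := H w => /(_ [::] isT) /=; lra.
have Dr a v : 0 <= D * blocks a v by rewrite mulr_ge0// blocks_ge0.
elim: w => [|i w [IHu IHb]].
  by split=> u hu; rewrite cats0 /= ?cats0; [have := Hu u hu | have := Hb u hu]; lra.
split=> u hu.
- case: i.
  + have := IHu (rcons u qm); rewrite all_rcons cat_rcons hu /= add0r. by move=> /(_ isT).
  + by have := IHu (rcons u q0); rewrite all_rcons cat_rcons hu /= add0r => /(_ isT).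
  + have := L_cat u (q1 :: w); have := IHb [:: q1] isT; have := Hu u hu.
    by rewrite runs_cat1 /=; lra.
- case: i.
  + have := L_cat u (qm :: w); have := IHu [:: qm] isT; have := Hb u hu.
    by rewrite ones_cat /=; lra.
  + by have := IHb (rcons u q0); rewrite all_rcons cat_rcons hu /= => /(_ isT).
  + by have := IHb (rcons u q1); rewrite all_rcons cat_rcons hu /= add0r => /(_ isT).
Qed.

Lemma cost_sublinear (eps : R) : 0 < eps ->
  exists e, forall w, L w <= eps * (size w)%:R + e.
Proof.
have C0 := C_ge0; move=> eps0; have M2 := M_ge2 R m_ge2.
(* Budget for the final coefficients: once [D / K%:R <= t], the invariant below bounds [a + b] by
   [t + M ^+ 2 * t + M ^+ 2 * t], and the coefficient of the blocks is at most [t]. *)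
pose t := eps / (M ^+ 2 + M ^+ 2 + 2 + 1).
have den0 : 0 < M ^+ 2 + M ^+ 2 + 2 + 1 by have := exprn_ge0 2 (ler0n R m); lra.
have t0 : 0 < t by rewrite divr_gt0.
have [D D0 HD] := cost_pieces t0.
have [K K0 DK] : exists2 K, (0 < K)%N & D / K%:R <= t.
  exists (Num.trunc (D / t)).+1 => //.
  rewrite ler_pdivrMr ?ltr0n// mulrC -ler_pdivrMr//.
  by rewrite ltW// truncnS_gt.
set k := M^-1 ^+ K.
have k0 : 0 < k by rewrite exprn_gt0// invr_gt0; lra.
have k1 : k <= 1 by apply: exprn_ile1; rewrite ?invr_ge0 ?invf_le1; lra.
(* Each section step sends the coefficients [(a, b, d)] of runs, [q1]s and
   blocks to those of [cost_step]; this combination of them is invariant, while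
   [d] decays geometrically. *)
have H n : exists a b e, [/\ 0 <= a, 0 <= b,
    b + M ^+ 2 * a + M ^+ 2 * (D * (1 - k) ^+ n / K%:R) =
    t + M ^+ 2 * t + M ^+ 2 * (D / K%:R)
  & forall w, L w <= a * runs false w + b * ones w + D * (1 - k) ^+ n * blocks false w + e].
  elim: n => [|n [a [b [e [a0 b0 ab Hn]]]]].
    by exists t, t, D; rewrite !ltW// expr0 mulr1.
  have d0 : 0 <= D * (1 - k) ^+ n by rewrite mulr_ge0// exprn_ge0// subr_ge0.
  have [e' He'] := cost_step K0 a0 d0 Hn.
  exists (a * (1 - M^-1) + D * (1 - k) ^+ n * (k / K%:R)), (b + M * a), e'.
  split; last by move=> w; rewrite (exprSr (1 - k)) (mulrA D); exact: He'.
  - rewrite addr_ge0// mulr_ge0//; first by rewrite subr_ge0 invf_le1; lra.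
    by rewrite divr_ge0// ltW.
  - by rewrite addr_ge0// mulr_ge0//; lra.
  - rewrite -ab (exprSr (1 - k)); field.
    by rewrite pnatr_eq0 -lt0n K0 /=; apply/eqP; lra.
have [n hn] : exists n, (1 - k) ^+ n < t / (D + 1).
  by apply: expr_small; rewrite ?divr_gt0//; lra.
have [a [b [e [a0 b0 ab Hn]]]] := H n.
exists e => w; apply: (le_trans (Hn w)); rewrite lerD2r.
have d0 : 0 <= D * (1 - k) ^+ n by rewrite mulr_ge0// exprn_ge0// subr_ge0.
have dt : D * (1 - k) ^+ n <= t.
  move: hn; rewrite ltr_pdivlMr; last by lra.
  have : 0 <= (1 - k) ^+ n by rewrite exprn_ge0// subr_ge0.
  lra.
have [rs os bs] := counts_le_size R w.
have sz : 0 <= (size w)%:R :> R by [].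
apply: (@le_trans _ _ ((a + b + D * (1 - k) ^+ n) * (size w)%:R)).
  have := ler_wpM2l a0 rs; have := ler_wpM2l b0 os; have := ler_wpM2l d0 bs; lra.
apply: ler_wpM2r => //.
have M21 : 1 <= M ^+ 2 by rewrite exprn_ege1//; lra.
have aM : a <= M ^+ 2 * a by rewrite ler_peMl.
have -> : eps = t * (M ^+ 2 + M ^+ 2 + 2 + 1) by rewrite /t divfK// gt_eqF.
have h1 : M ^+ 2 * (D / K%:R) <= M ^+ 2 * t by rewrite ler_wpM2l//; lra.
have h2 : 0 <= M ^+ 2 * (D * (1 - k) ^+ n / K%:R).
  by apply: mulr_ge0; [lra|exact: divr_ge0].
lra.
Qed.

End Cost.

(** * Sections of automorphisms *)

Section Sections.
Local Open Scope classical_set_scope.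
Local Open Scope group_scope.
Variable m : nat.
Implicit Types (g h : tree_aut m) (x y : 'I_m) (w u : seq 'I_m).

Lemma act_size g w : size (act g w) = size w.
Proof. by case: (svalP g) => _ + _; exact. Qed.

Lemma act_prefix g u w : prefix u w -> prefix (act g u) (act g w).
Proof. by case: (svalP g) => _ _; exact. Qed.

Lemma act_injective g : injective (act g).
Proof. by case: (svalP g) => /bij_inj. Qed.

Lemma actM g h w : act (g * h) w = act h (act g w).
Proof. by []. Qed.

Lemma act1 w : act (1 : tree_aut m) w = w.
Proof. by []. Qed.

Definition root_map g x := head x (act g [:: x]).

Lemma act_letter g x : act g [:: x] = [:: root_map g x].
Proof.
by rewrite /root_map; have := act_size g [:: x]; case: (act g _) => [|y []].
Qed.

Lemma root_map_inj g : injective (root_map g).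
Proof.
move=> x y xy; suff [] : [:: x] = [:: y] by [].
by apply: (@act_injective g); rewrite !act_letter xy.
Qed.

Definition root_perm g : 'S_m := perm (@root_map_inj g).

Definition sec_fun g x w := behead (act g (x :: w)).

Lemma act_sec_fun g x w : act g (x :: w) = root_perm g x :: sec_fun g x w.
Proof.
have := @act_prefix g [:: x] (x :: w); rewrite prefix_cons eqxx prefix0s => /(_ isT).
rewrite act_letter permE /sec_fun.
by case: (act g (x :: w)) => [|y v] //= /andP[/eqP->].
Qed.

Lemma actKV g w : act g^-1 (act g w) = w.
Proof. by rewrite -actM mulgV. Qed.

Lemma root_permV g x : root_perm g^-1 (root_perm g x) = x.
Proof. by have := actKV g [:: x]; rewrite !act_sec_fun => -[]. Qed.

Lemma sec_funV g x : cancel (sec_fun g x) (sec_fun g^-1 (root_perm g x)).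
Proof. by move=> w; rewrite {1}/sec_fun -act_sec_fun actKV. Qed.

Lemma sec_fun_aut g x : is_tree_aut (sec_fun g x).
Proof.
apply: (@is_tree_aut_can _ _ (sec_fun g^-1 (root_perm g x))).
- exact: sec_funV.
- by move=> w; have := @sec_funV g^-1 (root_perm g x) w; rewrite invgK root_permV.
- by move=> w; rewrite size_behead act_size.
- move=> u v uv; have := @act_prefix g (x :: u) (x :: v).
  by rewrite !act_sec_fun !prefix_cons !eqxx; exact.
Qed.

Definition sec g x : tree_aut m := exist _ (sec_fun g x) (sec_fun_aut g x).

Lemma act_cons g x w : act g (x :: w) = root_perm g x :: act (sec g x) w.
Proof. exact: act_sec_fun. Qed.

Lemma act_nil g : act g [::] = [::].
Proof. by apply/size0nil; rewrite act_size. Qed.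

Lemma tree_autP g h : root_perm g = root_perm h -> sec g =1 sec h -> g = h.
Proof.
move=> gh1 gh2; apply: act_inj => -[|x w]; first by rewrite !act_nil.
by rewrite !act_cons gh1 gh2.
Qed.

Lemma root_permP g (s : 'S_m) (f : 'I_m -> seq 'I_m -> seq 'I_m) :
  (forall x w, act g (x :: w) = s x :: f x w) ->
  root_perm g = s /\ forall x w, act (sec g x) w = f x w.
Proof.
move=> H; split; first by apply/permP => x; have := H x [::]; rewrite act_cons => -[].
by move=> x w; have := H x w; rewrite act_cons => -[].
Qed.

Lemma root_permM g h : root_perm (g * h) = (root_perm g * root_perm h)%g.
Proof.
apply/permP => x; have := act_cons (g * h) x [::].
by rewrite actM !act_cons permM => -[].
Qed.

Lemma secM g h x : sec (g * h) x = sec g x * sec h (root_perm g x).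
Proof.
apply: act_inj => w; have := act_cons (g * h) x w.
by rewrite !actM !act_cons => -[].
Qed.

Lemma root_perm1 : root_perm (1 : tree_aut m) = 1%g.
Proof. by apply/permP => x; have := act_cons 1 x [::]; rewrite act1 perm1 => -[]. Qed.

Lemma sec1 x : sec 1 x = 1.
Proof. by apply: act_inj => w; have := act_cons 1 x w; rewrite act1 => -[]. Qed.

Lemma sec_inv g x : sec g^-1 (root_perm g x) = (sec g x)^-1.
Proof.
by apply: (mulgI (sec g x)); rewrite -secM !mulgV sec1.
Qed.

Lemma root_perm_rooted (s : 'S_m) : root_perm (rooted s) = s.
Proof. by have [] := @root_permP (rooted s) s (fun _ w => w) (fun _ _ => erefl). Qed.

Lemma sec_rooted (s : 'S_m) x : sec (rooted s) x = 1.
Proof.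
by apply: act_inj => w; have [_ ->] := @root_permP (rooted s) s (fun _ w => w) (fun _ _ => erefl).
Qed.

(* Junk value [1] when [f] is not an automorphism. *)
Definition mk_aut (f : seq 'I_m -> seq 'I_m) : tree_aut m :=
  if pselect (is_tree_aut f) is left p then exist _ f p else 1.

Lemma mk_autE g f : act g =1 f -> mk_aut f = g.
Proof.
move=> gf; rewrite /mk_aut; case: pselect => [p|[]].
  by apply: act_inj => w; rewrite gf.
by rewrite -(funext gf); exact: svalP g.
Qed.

(* [<<h_0, ..., h_(m-1)>> s] *)
Definition node_fun (s : 'S_m) (hs : 'I_m -> tree_aut m) w :=
  if w is x :: w' then s x :: act (hs x) w' else [::].

(* [<<g, h_1, ..., h_(m-1)>> s], where [g] is the automorphism being defined. *)
Fixpoint fix_fun (s : 'S_m) (hs : 'I_m -> tree_aut m) w :=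
  if w is x :: w' then
    s x :: if x == 0%N :> nat then fix_fun s hs w' else act (hs x) w'
  else [::].

Definition node s hs := mk_aut (node_fun s hs).
Definition fixpt s hs := mk_aut (fix_fun s hs).

Lemma nodeE g : g = node (root_perm g) (sec g).
Proof. by rewrite /node (mk_autE (g := g))// => -[|x w]; rewrite ?act_nil ?act_cons. Qed.

Definition self_similar0 g := forall x, x = 0%N :> nat -> sec g x = g.

Lemma fixptE g hs : self_similar0 g ->
  (forall x, x <> 0%N :> nat -> sec g x = hs x) -> g = fixpt (root_perm g) hs.
Proof.
move=> g0 gh; rewrite /fixpt (mk_autE (g := g))//; elim=> [|x w IH]; first by rewrite act_nil.
rewrite act_cons [RHS]/=; congr cons.
by case: eqP => x0; [rewrite g0// IH | rewrite gh].
Qed.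

End Sections.

(** * Programs computing automorphisms *)

Section Machine.
Local Open Scope classical_set_scope.
Local Open Scope group_scope.
Variable m : nat.
Implicit Types (g h : tree_aut m) (st : seq (tree_aut m)).

(* Programs of a stack machine over automorphisms.  [Node s] and [Fix s] pop
   [m] entries; [Fix s] ignores the entry of the letter 0. *)
Inductive op := Gen of 'S_m | Node of 'S_m | Fix of 'S_m | Mul.

Definition op_code (o : op) : 'S_m + 'S_m + 'S_m + unit :=
  match o with
  | Gen s => inl (inl (inl s)) | Node s => inl (inl (inr s))
  | Fix s => inl (inr s) | Mul => inr tt
  end.

Definition op_decode (c : 'S_m + 'S_m + 'S_m + unit) : op :=
  match c with
  | inl (inl (inl s)) => Gen s | inl (inl (inr s)) => Node s
  | inl (inr s) => Fix s | inr tt => Mul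
  end.

Lemma op_codeK : cancel op_code op_decode. Proof. by case. Qed.

HB.instance Definition _ := Finite.copy op (can_type op_codeK).

Implicit Types (p : seq op).

Definition step st (o : op) :=
  match o with
  | Gen s => rooted s :: st
  | Node s => node s (fun x => nth 1 st x) :: drop m st
  | Fix s => fixpt s (fun x => nth 1 st x) :: drop m st
  | Mul => (nth 1 st 1%N * nth 1 st 0%N) :: drop 2 st
  end.

(** Leaving the stack below arbitrary lets a program run inside larger ones. *)
Definition computes p g := forall st, foldl step st p = g :: st.

Definition computable g := exists p, computes p g.

Lemma computes_inj p g h : computes p g -> computes p h -> g = h.
Proof. by move=> pg ph; have := pg [::]; rewrite ph => -[]. Qed.

Lemma prog_length_subproof g : computable g ->
  exists n, `[< exists2 p, computes p g & size p = n >].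
Proof. by move=> [p pg]; exists (size p); apply/asboolP; exists p. Qed.

(* Junk value 0 when no program computes [g]. *)
Definition prog_length g : nat :=
  if pselect (computable g) is left gc then ex_minn (prog_length_subproof gc)
  else 0.

Lemma prog_lengthP g : computable g ->
  exists2 p, computes p g & size p = prog_length g.
Proof.
move=> gc; rewrite /prog_length; case: pselect => // gc'.
by case: ex_minnP => n /asboolP.
Qed.

Lemma prog_length_le p g : computes p g -> (prog_length g <= size p)%N.
Proof.
move=> pg; rewrite /prog_length; case: pselect => // gc.
by case: ex_minnP => n _; apply; apply/asboolP; exists p.
Qed.

Lemma computes_rooted s : computes [:: Gen s] (rooted s).
Proof. by []. Qed.

Lemma prog_length_rooted s : computable (rooted s) /\ (prog_length (rooted s) <= 1)%N.
Proof.
by split; [exists [:: Gen s]|apply: (prog_length_le (computes_rooted s))].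
Qed.

Lemma computesM p q g h :
  computes p g -> computes q h -> computes (p ++ q ++ [:: Mul]) (g * h).
Proof. by move=> pg qh st; rewrite !foldl_cat pg qh /= drop0. Qed.

Lemma prog_lengthM g h : computable g -> computable h ->
  computable (g * h) /\
  (prog_length (g * h)%g <= prog_length g + prog_length h + 1)%N.
Proof.
move=> /prog_lengthP[p pg <-] /prog_lengthP[q qh <-].
have H := computesM pg qh; split; first by exists (p ++ q ++ [:: Mul]).
by apply: leq_trans (prog_length_le H) _; rewrite !size_cat addnA.
Qed.

Lemma push_tuple (P : 'I_m -> seq op) (f : 'I_m -> tree_aut m) st :
  (forall x, computes (P x) (f x)) ->
  foldl step st (flatten (map P (rev (enum 'I_m)))) = map f (enum 'I_m) ++ st.
Proof.
move=> H; elim: (enum _) => [|x l IH] //=.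
by rewrite rev_cons map_rcons flatten_rcons foldl_cat IH H.
Qed.

Lemma nth_push (f : 'I_m -> tree_aut m) st :
  (fun x : 'I_m => nth 1 (map f (enum 'I_m) ++ st) x) = f.
Proof.
apply/funext => x.
by rewrite nth_cat size_map size_enum_ord ltn_ord (nth_map x) ?size_enum_ord// nth_ord_enum.
Qed.

Lemma drop_push (f : 'I_m -> tree_aut m) st : drop m (map f (enum 'I_m) ++ st) = st.
Proof. by rewrite drop_size_cat// size_map size_enum_ord. Qed.

Lemma size_push (P : 'I_m -> seq op) :
  size (flatten (map P (rev (enum 'I_m)))) = \sum_x size (P x).
Proof.
rewrite size_flatten /shape -map_comp sumnE big_map.
by rewrite (perm_big _ (permEl (perm_rev _))) big_enum.
Qed.

Lemma prog_length_sec g : (forall x, computable (sec g x)) ->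
  computable g /\ (prog_length g <= \sum_x prog_length (sec g x) + 1)%N.
Proof.
move=> H; have P x : {p | computes p (sec g x) & size p = prog_length (sec g x)}.
  by apply: cid2; exact: prog_lengthP.
have Hg : computes (flatten [seq s2val (P x) | x <- rev (enum 'I_m)] ++
    [:: Node (root_perm g)]) g.
  move=> st; rewrite foldl_cat (@push_tuple (fun x => s2val (P x)) (sec g)); last first.
    by move=> x; exact: s2valP (P x).
  by rewrite /= nth_push drop_push -nodeE.
split; first by eexists; exact: Hg.
apply: leq_trans (prog_length_le Hg) _; rewrite size_cat size_push leq_add2r.
by rewrite (eq_bigr _ (fun x _ => s2valP' (P x))).
Qed.

Lemma prog_length_fix g : self_similar0 g ->
  (forall x : 'I_m, x <> 0%N :> nat -> computable (sec g x)) ->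
  computable g /\
  (prog_length g <= \sum_(x : 'I_m | x != 0%N :> nat) prog_length (sec g x) + m + 1)%N.
Proof.
move=> g0 H.
(* The letter 0 gets a placeholder program of length 1, paid for by the term [m]. *)
pose f (x : 'I_m) := if x == 0%N :> nat then rooted 1%g else sec g x.
have P x : {p | computes p (f x) &
    size p = if x == 0%N :> nat then 1%N else prog_length (sec g x)}.
  apply: cid2; rewrite /f; case: eqP => x0; first by exists [:: Gen 1%g].
  exact/prog_lengthP/H.
have Hg : computes (flatten [seq s2val (P x) | x <- rev (enum 'I_m)] ++
    [:: Fix (root_perm g)]) g.
  move=> st; rewrite foldl_cat (@push_tuple (fun x => s2val (P x)) f); last first.
    by move=> x; exact: s2valP (P x).
  rewrite /= nth_push drop_push; congr (_ :: _).
  by apply/esym/fixptE => // x /eqP x0; rewrite /f (negPf x0).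
split; first by eexists; exact: Hg.
apply: leq_trans (prog_length_le Hg) _; rewrite size_cat size_push leq_add2r.
rewrite (eq_bigr _ (fun x _ => s2valP' (P x))) (bigID (fun x : 'I_m => x != 0%N :> nat)) /=.
apply: leq_add; first by apply: leq_sum => x /negPf ->.
apply: (@leq_trans (\sum_(x : 'I_m) 1)%N); last by rewrite sum1_card card_ord.
by rewrite big_mkcond; apply: leq_sum => x _; case: eqP.
Qed.

End Machine.

(** * Kraft's inequality for finite words *)

Section Kraft.
Local Open Scope classical_set_scope.
Local Open Scope group_scope.
Variables (R : realType) (T : finType) (x : R).
Hypotheses (x_ge0 : (0 <= x)%R) (x_small : (x * #|T|%:R * 2 <= 1)%R).
Local Open Scope ring_scope.

(** The factor 2 in [x_small] replaces prefix-freeness: all words of length [n] together weigh at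
    most [2^-n]. The induction removes the first letter, using [1 + #|T| * x * 2 <= 2]. *)
Lemma kraft_words (l : seq (seq T)) : uniq l -> \sum_(s <- l) x ^+ size s <= 2.
Proof.
have x0 := x_ge0; have xs := x_small.
move=> ul; have [K lK] : exists K, forall s, s \in l -> (size s < K)%N.
  exists (\max_(s <- l) size s).+1 => s sl.
  by rewrite ltnS; exact: leq_bigmax_seq.
elim: K l lK ul => [|K IH] l lK ul; first by rewrite big_seq big1 => // s /lK.
rewrite (bigID (fun s : seq T => s == [::])) /=.
have -> : 2 = 1 + 1 :> R by [].
apply: lerD.
  rewrite -big_filter; have : uniq [seq s <- l | s == [::]] by rewrite filter_uniq.
  have : all (pred1 [::]) [seq s <- l | s == [::]] by exact: filter_all.
  case: [seq _ <- _ | _] => [|s [|t r]] /=; first by rewrite big_nil.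
    by move=> /andP[/eqP -> _] _; rewrite big_seq1 expr0.
  by move=> /and3P[/eqP -> /eqP -> _]; rewrite inE eqxx.
have tails (o : T) : \sum_(s <- l | ohead s == Some o) x ^+ size s <= x * 2.
  pose lo := [seq behead s | s <- l & ohead s == Some o].
  rewrite -big_filter.
  have -> : \sum_(s <- [seq s <- l | ohead s == Some o]) x ^+ size s =
      x * \sum_(s <- lo) x ^+ size s.
    rewrite big_map mulr_sumr big_seq [RHS]big_seq; apply: eq_bigr => s.
    by rewrite mem_filter; case: s => [|a s] //= _; rewrite exprS.
  rewrite ler_wpM2l// IH//; last first.
    rewrite map_inj_in_uniq ?filter_uniq// => s t; rewrite !mem_filter.
    by case: s t => [|a s] [|b t] //= /andP[/eqP[->] _] /andP[/eqP[->] _] ->.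
  by move=> t /mapP[s]; rewrite mem_filter => /andP[/eqP so /lK +] ->; case: s so.
apply: (@le_trans _ _ (\sum_(o : T) x * 2)); last first.
  by rewrite sumr_const -mulr_natl; move: xs; rewrite cardT/=; lra.
apply: le_trans (ler_sum _ (fun o _ => tails o)).
rewrite (exchange_big_dep predT)//= big_mkcond/=; apply: ler_sum => s _.
case: s => [|o s] /=; first by rewrite big1.
by rewrite (bigD1 o)//= lerDl sumr_ge0 => // i _; rewrite exprn_ge0.
Qed.

End Kraft.

(** * Level groups *)

Section Subgroups.
Local Open Scope classical_set_scope.
Local Open Scope group_scope.
Variable G : groupType.
Implicit Types (H K S : set G) (x y : G).

Lemma subgroup1 H : is_subgroup H -> H 1. Proof. by case. Qed.

Lemma subgroupV H x : is_subgroup H -> H x -> H x^-1.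
Proof. by move=> [H1 HV] Hx; rewrite -(mul1g x^-1); exact: HV. Qed.

Lemma subgroupM H x y : is_subgroup H -> H x -> H y -> H (x * y).
Proof.
by move=> sH Hx Hy; rewrite -(invgK y); apply: sH.2 => //; exact: subgroupV.
Qed.

Lemma is_subgroupP H : H 1 -> (forall x y, H x -> H y -> H (x * y)) ->
  (forall x, H x -> H x^-1) -> is_subgroup H.
Proof. by move=> H1 HM HV; split=> // x y Hx Hy; apply/HM/HV. Qed.

Lemma generated_subgroup S : is_subgroup (generated S).
Proof.
split=> [|x y Hx Hy] H [sH SH]; first exact: subgroup1.
by apply: sH.2; [exact: Hx|exact: Hy].
Qed.

Lemma sub_generated S : S `<=` generated S.
Proof. exact: sub_smallest. Qed.

Lemma generated_sub S H : is_subgroup H -> S `<=` H -> generated S `<=` H.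
Proof. exact: smallest_sub. Qed.

End Subgroups.

(** * Averages over finite subgroups *)

Section Average.
Local Open Scope classical_set_scope.
Local Open Scope group_scope.
Variables (R : realType) (G : groupType).
Implicit Types (A B : set G) (F : G -> R).
Local Open Scope ring_scope.

Definition avg A F : R := (\sum_(a <- fset_set A) F a) / (#|` fset_set A|)%:R.

Lemma eq_avg A F1 F2 : finite_set A -> (forall a, A a -> F1 a = F2 a) ->
  avg A F1 = avg A F2.
Proof.
move=> fA H; rewrite /avg; congr (_ / _); rewrite big_seq [RHS]big_seq.
by apply: eq_bigr => a; rewrite in_fset_set// inE => /H.
Qed.

Lemma le_avg A F1 F2 : finite_set A -> (forall a, A a -> F1 a <= F2 a) ->
  avg A F1 <= avg A F2.
Proof.
move=> fA H; rewrite /avg ler_wpM2r ?invr_ge0// big_seq [leRHS]big_seq.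
by apply: ler_sum => a; rewrite in_fset_set// inE => /H.
Qed.

Lemma avg_cst A (c : R) : finite_set A -> A !=set0 -> avg A (fun=> c) = c.
Proof.
move=> fA [a Aa]; rewrite /avg big_const_seq count_predT iter_addr_0.
rewrite -(mulr_natr c) mulfK// pnatr_eq0 cardfs_eq0; apply/negP => /eqP A0.
by have : a \in fset_set A; [rewrite in_fset_set// inE|rewrite A0 inE].
Qed.

Lemma avgD A F1 F2 : avg A (fun a => F1 a + F2 a) = avg A F1 + avg A F2.
Proof. by rewrite /avg big_split/= mulrDl. Qed.

Lemma avg_sum A (I : finType) (P : pred I) (F : I -> G -> R) :
  avg A (fun a => \sum_(i | P i) F i a) = \sum_(i | P i) avg A (F i).
Proof. by rewrite /avg exchange_big/= mulr_suml. Qed.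

Lemma avg_exchange A B (F : G -> G -> R) :
  avg A (fun a => avg B (F a)) = avg B (fun b => avg A (F^~ b)).
Proof.
rewrite /avg -!mulr_suml exchange_big/= -!mulrA; congr (_ * _).
by rewrite mulrC.
Qed.

Lemma perm_avg A F (f : G -> G) : finite_set A -> (forall a, A a -> A (f a)) ->
  injective f -> avg A (F \o f) = avg A F.
Proof.
move=> fA fAA fi; rewrite /avg; congr (_ / _).
rewrite -[LHS](big_map f predT F); apply: perm_big.
have ur : uniq (map f (fset_set A)) by rewrite map_inj_uniq// fset_uniq.
apply: uniq_perm => //; first exact: fset_uniq.
apply: (uniq_min_size ur _ _).2; last by rewrite size_map.
move=> b /mapP[a]; rewrite !in_fset_set// !inE => Aa ->; exact: fAA.
Qed.

Lemma avg_mull A F b : finite_set A -> is_subgroup A -> A b ->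
  avg A (fun a => F (b * a)%g) = avg A F.
Proof.
move=> fA sA Ab; apply: (perm_avg F fA) => [a Aa|]; first exact: subgroupM.
exact: mulgI.
Qed.

Lemma avg_mulr A F b : finite_set A -> is_subgroup A -> A b ->
  avg A (fun a => F (a * b)%g) = avg A F.
Proof.
move=> fA sA Ab; apply: (perm_avg F fA (f := fun a => (a * b)%g)) => [a Aa|].
  exact: subgroupM.
exact: mulIg.
Qed.

(** [f] need not be a morphism: it only has to turn left translation by a lift [b'] into left
    translation by [b], which makes the image of the uniform law invariant under [B]. This suits the
    section at a letter that elements of [A] may move. *)
Lemma avg_transfer A B F (f : G -> G) :
  finite_set A -> A !=set0 -> finite_set B -> is_subgroup B ->
  is_subgroup A -> (forall a, A a -> B (f a)) ->
  (forall b, B b -> exists2 b', A b' & forall a, A a -> f (b' * a)%g = (b * f a)%g) ->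
  avg A (fun a => F (f a)) = avg B F.
Proof.
move=> fA A0 fB sB sA fAB H.
have B0 : B !=set0 by exists 1%g; exact: subgroup1.
transitivity (avg B (fun b => avg A (fun a => F (b * f a)%g))).
  rewrite -[LHS](avg_cst _ fB B0); apply: eq_avg => // b Bb.
  have [b' Ab' b'E] := H b Bb.
  rewrite -(avg_mull (fun a => F (f a)) fA sA Ab').
  by apply: eq_avg => // a Aa; rewrite b'E.
rewrite avg_exchange -[RHS](avg_cst _ fA A0); apply: eq_avg => // a Aa.
by apply: avg_mulr => //; exact: fAB.
Qed.

End Average.

Section LevelGroups.
Local Open Scope classical_set_scope.
Local Open Scope group_scope.
Variable m : nat.
Implicit Types (g h : tree_aut m) (x y : 'I_m) (B : set (tree_aut m)).

Definition level_index (i : letter) : option nat :=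
  match i with qm => None | q0 => Some 0%N | q1 => Some 1%N end.

Definition level (i : letter) : set (tree_aut m) := level_group m (level_index i).

Lemma rootedM (s t : 'S_m) : rooted s * rooted t = rooted (s * t)%g.
Proof.
apply: tree_autP; first by rewrite root_permM !root_perm_rooted.
by move=> x; rewrite secM !sec_rooted mulg1.
Qed.

Lemma rooted1 : rooted (1 : 'S_m)%g = 1.
Proof.
apply: tree_autP; first by rewrite root_perm_rooted root_perm1.
by move=> x; rewrite sec_rooted sec1.
Qed.

Lemma level_qm_subgroup : is_subgroup (level qm).
Proof.
apply: is_subgroupP => [|_ _ [s ->] [t ->]|_ [s ->]].
- by exists 1%g; rewrite rooted1.
- by exists (s * t)%g; rewrite rootedM.
- by exists s^-1%g; apply: (mulgI (rooted s)); rewrite mulgV rootedM mulgV rooted1.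
Qed.

Lemma level_subgroup i : is_subgroup (level i).
Proof. by case: i; [exact: level_qm_subgroup|exact: generated_subgroup..]. Qed.

Lemma root_permV1 g : root_perm g^-1 = (root_perm g)^-1%g.
Proof.
by apply: (mulgI (root_perm g)); rewrite -root_permM !mulgV root_perm1.
Qed.

Lemma sec_inv1 g y : sec g^-1 y = (sec g (root_perm g^-1 y))^-1.
Proof.
by rewrite -sec_inv; congr (sec _ _); rewrite root_permV1 permKV.
Qed.

(** For suitable [P] and [B] this contains [level q0] or [level q1], and it gives their finiteness
    and the shape of their sections. *)
Definition self_similar_over (P : 'S_m -> Prop) B : set (tree_aut m) :=
  [set g | [/\ self_similar0 g, P (root_perm g) &
    forall x, x <> 0%N :> nat -> B (sec g x)]].

Lemma self_similar_subgroup (P : 'S_m -> Prop) B :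
  (forall s, P s -> fixes0 s) -> P 1%g ->
  (forall s t, P s -> P t -> P (s * t)%g) -> (forall s, P s -> P s^-1%g) ->
  is_subgroup B -> is_subgroup (self_similar_over P B).
Proof.
move=> P0 P1 PM PV sB.
have nz s x : P s -> x <> 0%N :> nat -> s x <> 0%N :> nat.
  by move=> /P0 Ps /eqP x0; apply/eqP; rewrite fixes0_eq0.
apply: is_subgroupP => [|g h [g0 gP gB] [h0 hP hB]|g [g0 gP gB]].
- split=> [x _||x _]; rewrite ?sec1 ?root_perm1//; exact: subgroup1.
- split=> [x x0||x x0].
  + by rewrite secM g0// h0// (P0 _ gP).
  + by rewrite root_permM; exact: PM.
  + by rewrite secM; apply: subgroupM => //; [exact: gB|exact/hB/nz].
- split=> [x x0||x x0].
  + by rewrite sec_inv1 root_permV1 (P0 _ (PV _ gP))// g0.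
  + by rewrite root_permV1; exact: PV.
  + rewrite sec_inv1; apply: subgroupV => //; apply: gB.
    by rewrite root_permV1; apply: nz => //; exact: PV.
Qed.

(** By [fixptE] an element is recovered from its root permutation and its sections in [B] at nonzero
    letters. *)
Lemma finite_self_similar (P : 'S_m -> Prop) B : B 1 ->
  finite_set B -> finite_set (self_similar_over P B).
Proof.
move=> B1 fB; pose r := enum_fset (fset_set B).
pose f (p : 'S_m * {ffun 'I_m -> 'I_(size r).+1}) :=
  fixpt p.1 (fun x => nth 1 r (p.2 x)).
apply: (@sub_finite_set _ _ (f @` setT)); last exact/finite_image/finite_finset.
move=> g [g0 _ gB].
exists (root_perm g, [ffun x => inord (index (sec g x) r)]) => //.
rewrite /f /=; apply/esym/fixptE => // x x0.
have xr : sec g x \in r by rewrite in_fset_set// inE; exact: gB.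
by rewrite ffunE inordK ?nth_index// ltnS index_size.
Qed.

Lemma root_perm_lambda_nil (s : two_level m) :
  root_perm (lambda [::] s) = top s.
Proof.
apply/permP => x; have := act_cons (lambda [::] s) x [::].
rewrite /act /=; case: eqP => [x0 [<-]|x0 [<-]] //.
by rewrite (top_fixes0 s).
Qed.

Lemma sec_lambda_nil (s : two_level m) x :
  sec (lambda [::] s) x = if x == 0%N :> nat then lambda [::] s else rooted (bot s x).
Proof.
by apply: act_inj => w; have := act_cons (lambda [::] s) x w;
  rewrite {1}/act /=; case: eqP => _ [].
Qed.

Lemma root_perm_lambda1 a (s : two_level m) : root_perm (lambda [:: a] s) = 1%g.
Proof.
apply/permP => x; have := act_cons (lambda [:: a] s) x [::].
by rewrite /act /= perm1; case: eqP => _; [case=> <-|case: eqP => _ [<-]].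
Qed.

Lemma sec_lambda1 a (s : two_level m) x :
  sec (lambda [:: a] s) x = if x == 0%N :> nat then lambda [:: a] s
    else if x == a then lambda [::] s else 1.
Proof.
apply: act_inj => w; have := act_cons (lambda [:: a] s) x w.
by rewrite {1}/act /=; case: eqP => _; [case|case: eqP => _ []].
Qed.

Lemma level_q0_sub : level q0 `<=` self_similar_over (@fixes0 m) (level qm).
Proof.
apply: generated_sub.
  apply: self_similar_subgroup => //.
  - by move=> x _; rewrite perm1.
  - by move=> s t fs ft x x0; rewrite permM fs// ft.
  - by move=> s; exact: fixes0V.
  - exact: level_subgroup.
move=> g [u [s [/size0nil -> _ ->]]]; split.
- by move=> x /eqP x0; rewrite sec_lambda_nil x0.
- by rewrite root_perm_lambda_nil; exact: top_fixes0.
- by move=> x /eqP /negPf x0; rewrite sec_lambda_nil x0; exists (bot s x).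
Qed.

Lemma level_q1_sub : level q1 `<=` self_similar_over (fun s => s = 1%g) (level q0).
Proof.
apply: generated_sub.
  apply: self_similar_subgroup => //.
  - by move=> s -> x _; rewrite perm1.
  - by move=> s t -> ->; rewrite mulg1.
  - by move=> s ->; rewrite invg1.
  - exact: level_subgroup.
move=> g [[|a [|b u]] [s [// _ /= ua ->]]]; split.
- by move=> x /eqP x0; rewrite sec_lambda1 x0.
- by rewrite root_perm_lambda1.
- move=> x /eqP /negPf x0; rewrite sec_lambda1 x0; case: ifP => _.
    by apply: sub_generated; exists [::], s.
  exact: (subgroup1 (level_subgroup q0)).
Qed.

Lemma finite_level i : finite_set (level i).
Proof.
have H0 : finite_set (level qm).
  apply: (@sub_finite_set _ _ (@rooted m @` setT)).
    by move=> _ [s ->]; exists s.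
  exact/finite_image/finite_finset.
have H1 : finite_set (level q0).
  apply: sub_finite_set level_q0_sub _; apply: finite_self_similar => //.
  exact: (subgroup1 (level_subgroup _)).
case: i => //; apply: sub_finite_set level_q1_sub _; apply: finite_self_similar => //.
exact: (subgroup1 (level_subgroup _)).
Qed.

Lemma level_neq0 i : level i !=set0.
Proof. by exists 1; exact: (subgroup1 (level_subgroup _)). Qed.

Lemma level_sec0 i g x : i <> qm -> level i g -> x = 0%N :> nat ->
  sec g x = g /\ root_perm g x = x.
Proof.
case: i => // _; first by move=> /level_q0_sub[g0 gP _] x0; rewrite g0// gP.
by move=> /level_q1_sub[g0 -> _] x0; rewrite g0// perm1.
Qed.

Section SectionAverage.
Variables (R : realType) (x : 'I_m).
Hypothesis x_neq0 : x <> 0%N :> nat.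

Lemma avg_sec_q0 (F : tree_aut m -> R) :
  avg (level q0) (fun a => F (sec a x)) = avg (level qm) F.
Proof.
apply: (avg_transfer F (f := fun a => sec a x)).
- exact: finite_level.
- exact: level_neq0.
- exact: finite_level.
- exact: level_subgroup.
- exact: level_subgroup.
- by move=> a /level_q0_sub[_ _]; exact.
move=> _ [s ->].
have t0 : fixes0 (1%g : 'S_m) by move=> y _; rewrite perm1.
have b0 y : y = 0%N :> nat -> (if y == x then s else 1%g) = 1%g.
  by move=> y0; case: eqP => // yx; case: x_neq0; rewrite -yx.
exists (lambda [::] (TwoLevel t0 b0));
  first by apply: sub_generated; exists [::], (TwoLevel t0 b0).
move=> a _; rewrite secM root_perm_lambda_nil sec_lambda_nil /= perm1 eqxx.
by move/eqP/negPf: x_neq0 => ->.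
Qed.

(** Root permutations in [level q1] are trivial, so the section at [x] is a morphism there; it is
    onto because [lambda [:: x] s] lifts [lambda [::] s]. *)
Lemma avg_sec_q1 (F : tree_aut m -> R) :
  avg (level q1) (fun a => F (sec a x)) = avg (level q0) F.
Proof.
apply: (avg_transfer F (f := fun a => sec a x)).
- exact: finite_level.
- exact: level_neq0.
- exact: finite_level.
- exact: level_subgroup.
- exact: level_subgroup.
- by move=> a /level_q1_sub[_ _]; exact.
move=> b b0.
suff [b' b'1 b'x] : exists2 b', level q1 b' & sec b' x = b.
  exists b' => // a _; rewrite secM b'x.
  by have [_ -> _] := level_q1_sub b'1; rewrite perm1.
move: b b0; apply: generated_sub.
  have s1 := level_subgroup q1.
  apply: is_subgroupP => [|_ _ [a a1 <-] [b b1 <-]|_ [a a1 <-]].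
  - by exists 1; [exact: subgroup1|rewrite sec1].
  - exists (a * b); first exact: (subgroupM s1 a1 b1).
    by rewrite secM; have [_ -> _] := level_q1_sub a1; rewrite perm1.
  - exists a^-1; first exact: (subgroupV s1 a1).
    by rewrite sec_inv1 root_permV1; have [_ -> _] := level_q1_sub a1; rewrite invg1 perm1.
move=> _ [u [s [/size0nil -> _ ->]]].
exists (lambda [:: x] s).
  by apply: sub_generated; exists [:: x], s; rewrite /= andbT; split=> //; apply/eqP.
by rewrite sec_lambda1 eqxx; move/eqP/negPf: x_neq0 => ->.
Qed.

End SectionAverage.

End LevelGroups.

Arguments level : clear implicits.
Arguments level_subgroup : clear implicits.
Arguments level_neq0 : clear implicits.
Arguments finite_level : clear implicits.

(** * Level groups inside the mother group *)

Section LambdaInMother.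
Local Open Scope classical_set_scope.
Local Open Scope group_scope.
Variable m : nat.
Hypothesis m_ge2 : (2 <= m)%N.
Implicit Types (s t : two_level m) (x y a : 'I_m) (u w : seq 'I_m).

Lemma rooted_fun1 w : rooted_fun (1 : 'S_m)%g w = w.
Proof. by case: w => //= x w; rewrite perm1. Qed.

Lemma rooted_funM (p q : 'S_m) w : rooted_fun q (rooted_fun p w) = rooted_fun (p * q)%g w.
Proof. by case: w => //= x w; rewrite permM. Qed.

Lemma fixes0M (p q : 'S_m) : fixes0 p -> fixes0 q -> fixes0 (p * q)%g.
Proof. by move=> fp fq x x0; rewrite permM fp// fq. Qed.

Lemma two_level_mul_subproof s t x : x = 0%N :> nat ->
  (bot s x * bot t (top s x))%g = 1%g.
Proof. by move=> x0; rewrite (top_fixes0 s)// !bot_fixes0// mulg1. Qed.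

Definition two_level_mul s t : two_level m :=
  TwoLevel (fixes0M (@top_fixes0 _ s) (@top_fixes0 _ t))
    (@two_level_mul_subproof s t).

Lemma lambdaM u s t : lambda u s * lambda u t = lambda u (two_level_mul s t).
Proof.
apply: act_inj => w; rewrite actM /act /=.
elim: w u => [|x w IH] u //=; case: ifPn => x0 /=; first by rewrite x0 IH.
case: u => [|a u] /=.
  by rewrite fixes0_eq0 ?(negPf x0) ?permM ?rooted_funM//; exact: top_fixes0.
by case: ifPn => xa /=; rewrite (negPf x0) ?xa ?IH// (negPf xa).
Qed.

Lemma eq_lambda u s t : top s = top t ->
  (forall x, x <> 0%N :> nat -> bot s x = bot t x) -> lambda u s = lambda u t.
Proof.
move=> st bst; apply: act_inj => w; rewrite /act /=.
elim: w u => [|x w IH] u //=; rewrite st.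
case: eqP => x0; first by rewrite IH.
by rewrite bst//; case: u => [|a u] //; case: ifP => // _; rewrite IH.
Qed.

Definition top_only (p : 'S_m) (p0 : fixes0 p) : two_level m :=
  @TwoLevel m p (fun=> 1%g) p0 (fun _ _ => erefl).

Lemma fixes01 : fixes0 (1 : 'S_m)%g.
Proof. by move=> x _; rewrite perm1. Qed.

Lemma bot_at_subproof x (p : 'S_m) (x0 : x <> 0%N :> nat) y : y = 0%N :> nat ->
  (if y == x then p else 1%g) = 1%g.
Proof. by move=> y0; case: eqP => // yx; case: x0; rewrite -yx. Qed.

Definition bot_at x (p : 'S_m) (x0 : x <> 0%N :> nat) : two_level m :=
  TwoLevel fixes01 (@bot_at_subproof x p x0).

Definition one_letter : 'I_m := Ordinal m_ge2.

Lemma one_neq0 : one_letter <> 0%N :> nat. Proof. by []. Qed.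

Lemma tperm_fixes0 x : x <> 0%N :> nat -> fixes0 (tperm one_letter x).
Proof.
move=> x0 y y0; rewrite tpermD// -val_eqE /=; first by rewrite y0.
by apply/eqP => xy; apply: x0; rewrite xy.
Qed.

Section Generate.
Variables (u : seq 'I_m) (H : set (tree_aut m)).
Hypothesis sH : is_subgroup H.
Hypothesis H_top : forall p (p0 : fixes0 p), H (lambda u (top_only p0)).
Hypothesis H_bot : forall p, H (lambda u (bot_at p one_neq0)).

Lemma lambda_bot_at x (x0 : x <> 0%N :> nat) p : H (lambda u (bot_at p x0)).
Proof.
have -> : lambda u (bot_at p x0) = lambda u (top_only (tperm_fixes0 x0)) *
    lambda u (bot_at p one_neq0) * lambda u (top_only (tperm_fixes0 x0)).
  rewrite !lambdaM; apply: eq_lambda => [|y y0] /=.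
    by rewrite mulg1 tperm2.
  rewrite mulg1 mul1g; congr (if _ then _ else _).
  by rewrite -{2}(tpermR one_letter x) (inj_eq perm_inj).
by apply: subgroupM => //; apply: subgroupM.
Qed.

Lemma lambda_generated s : H (lambda u s).
Proof.
pose b (r : seq 'I_m) y := if y \in r then bot s y else 1%g.
have b0 r y : y = 0%N :> nat -> b r y = 1%g.
  by move=> y0; rewrite /b bot_fixes0// if_same.
have Hb r : H (lambda u (TwoLevel fixes01 (b0 r))).
  elim: r => [|x r IH].
    have := H_top fixes01; congr (H _); exact: eq_lambda.
  have [x0|/eqP x0] := eqVneq (x : nat) 0%N.
    move: IH; congr (H _); apply: eq_lambda => //= y y0; rewrite /b inE.
    by case: eqP => // yx; case: y0; rewrite yx.
  have [xr|xr] := boolP (x \in r).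
    move: IH; congr (H _); apply: eq_lambda => //= y y0; rewrite /b inE.
    by case: eqP => // ->; rewrite xr.
  have := subgroupM sH (lambda_bot_at x0 (bot s x)) IH.
  rewrite lambdaM; congr (H _); apply: eq_lambda => [|y y0] /=; first by rewrite mulg1.
  rewrite perm1 /b inE; case: eqP => [->|_]; last by rewrite mul1g.
  by rewrite (negPf xr) mulg1.
have := subgroupM sH (Hb (enum 'I_m)) (H_top (@top_fixes0 _ s)).
rewrite lambdaM; congr (H _); apply: eq_lambda => [|y y0] /=; first by rewrite mul1g.
by rewrite /b mem_enum mulg1.
Qed.

End Generate.

Lemma mother_subgroup : is_subgroup (mother_group m 1).
Proof. exact: generated_subgroup. Qed.

Lemma mother_alpha k p : (k <= 1)%N -> mother_group m 1 (alpha k p).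
Proof. by move=> k1; apply: sub_generated; right; left; exists k, p. Qed.

Lemma mother_beta k p (p0 : fixes0 p) : (k <= 1)%N -> mother_group m 1 (beta k p0).
Proof. by move=> k1; apply: sub_generated; right; right; exists k, p, p0. Qed.

Lemma lambda_nil_alpha p : lambda [::] (bot_at p one_neq0) = alpha 0 p.
Proof.
apply: act_inj => w; rewrite /act /=; elim: w => [|x w IH] //=.
rewrite perm1 IH; case: ifP => // _.
by rewrite -val_eqE /=; case: ifP => // _; rewrite rooted_fun1.
Qed.

Lemma lambda_nil_beta p (p0 : fixes0 p) : lambda [::] (top_only p0) = beta 0 p0.
Proof.
apply: act_inj => w; rewrite /act /=; elim: w => [|x w IH] //=.
by rewrite rooted_fun1 IH; case: eqP => // x0; rewrite p0.
Qed.

Lemma lambda1_alpha p : lambda [:: one_letter] (bot_at p one_neq0) = alpha 1 p.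
Proof.
apply: act_inj => w; rewrite /act /=; elim: w => [|x w IH] //=.
rewrite IH; case: ifP => // _; rewrite -val_eqE /=; case: ifP => // _.
by have := congr1 (fun g => act g w) (lambda_nil_alpha p); rewrite /act /= => ->.
Qed.

Lemma lambda1_beta p (p0 : fixes0 p) : lambda [:: one_letter] (top_only p0) = beta 1 p0.
Proof.
apply: act_inj => w; rewrite /act /=; elim: w => [|x w IH] //=.
rewrite IH; case: ifP => // _; rewrite -val_eqE /=; case: ifP => // _.
by have := congr1 (fun g => act g w) (lambda_nil_beta p0); rewrite /act /= => ->.
Qed.

(** The generators [alpha] and [beta] only provide the prefix 1; exchanging 1 and [a] at the first
    nonzero letter gives the other prefixes. *)
Lemma lambda1_conj a (a0 : a <> 0%N :> nat) s :
  lambda [:: a] s = lambda [::] (top_only (tperm_fixes0 a0)) *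
    lambda [:: one_letter] s * lambda [::] (top_only (tperm_fixes0 a0)).
Proof.
apply: act_inj => w; rewrite !actM /act /=; elim: w => [|x w IH] //=.
case: ifPn => x0 /=; first by rewrite x0 /= x0 IH.
have tx : (tperm one_letter a x == 0%N :> nat) = false.
  by rewrite fixes0_eq0 ?(negPf x0)//; exact: tperm_fixes0.
have xa : (tperm one_letter a x == one_letter) = (x == a).
  by rewrite -[in RHS](inj_eq (@perm_inj _ (tperm one_letter a))) tpermR.
rewrite rooted_fun1 tx xa.
by case: ifP => _ /=; rewrite tx rooted_fun1 tpermK.
Qed.

Lemma level_mother i : level m i `<=` mother_group m 1.
Proof.
have sM := mother_subgroup.
have Mnil s : mother_group m 1 (lambda [::] s).
  apply: lambda_generated => // [p p0|p].
    by rewrite lambda_nil_beta; exact: mother_beta.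
  by rewrite lambda_nil_alpha; exact: mother_alpha.
case: i.
- by move=> _ [s ->]; apply: sub_generated; left; exists s.
- by apply: generated_sub => // _ [u [s [/size0nil -> _ ->]]].
apply: generated_sub => // _ [[|a [|b u]] [s [// _ /= /andP[/eqP a0 _] ->]]].
rewrite (lambda1_conj a0).
apply: (subgroupM sM _ (Mnil _)); apply: (subgroupM sM (Mnil _)).
apply: lambda_generated => // [p p0|p].
  by rewrite lambda1_beta; exact: mother_beta.
by rewrite lambda1_alpha; exact: mother_alpha.
Qed.

End LambdaInMother.

(** * Mean program length along a word *)

Section WordExpectation.
Local Open Scope classical_set_scope.
Local Open Scope group_scope.
Variables (R : realType) (m : nat).
Implicit Types (g h a : tree_aut m) (x y : 'I_m) (u v w : seq letter) (F : tree_aut m -> R).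
Local Open Scope ring_scope.

(* Expectation of [F] over a product of independent uniform elements of the
   level groups listed in [w]. *)
Fixpoint word_exp w F : R :=
  if w is i :: w' then avg (level m i) (fun a => word_exp w' (fun g => F (a * g)%g))
  else F 1%g.

(** The length estimates concern computable elements, so expectations are compared on the values
    attained along [w] only. *)
Fixpoint reach w g : Prop :=
  if w is i :: w' then exists a h, [/\ level m i a, reach w' h & g = (a * h)%g]
  else g = 1%g.

Lemma le_word_exp w F1 F2 : (forall g, reach w g -> F1 g <= F2 g) ->
  word_exp w F1 <= word_exp w F2.
Proof.
elim: w F1 F2 => [|i w IH] F1 F2 H /=; first exact: H.
apply: le_avg => [|a ia]; first exact: finite_level.
by apply: IH => g wg; apply: H; exists a, g.
Qed.

Lemma eq_word_exp w F1 F2 : F1 =1 F2 -> word_exp w F1 = word_exp w F2.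
Proof. by move=> H; apply/eqP; rewrite eq_le !le_word_exp// => g _; rewrite H. Qed.

Lemma word_exp_cst w (c : R) : word_exp w (fun=> c) = c.
Proof.
elim: w => [|i w IH] //=; rewrite IH avg_cst//; first exact: finite_level.
exact: level_neq0.
Qed.

Lemma word_expD w F1 F2 : word_exp w (fun g => F1 g + F2 g) = word_exp w F1 + word_exp w F2.
Proof.
elim: w F1 F2 => [|i w IH] F1 F2 //=.
by rewrite -avgD; apply: eq_avg => [|a _]; [exact: finite_level|exact: IH].
Qed.

Lemma word_exp_sum w (I : finType) (Q : pred I) (F : I -> tree_aut m -> R) :
  word_exp w (fun g => \sum_(i | Q i) F i g) = \sum_(i | Q i) word_exp w (F i).
Proof.
elim: w F => [|j w IH] F //=.
by rewrite -avg_sum; apply: eq_avg => [|a _]; [exact: finite_level|exact: IH].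
Qed.

Lemma word_exp_cat u v F :
  word_exp (u ++ v) F = word_exp u (fun g => word_exp v (fun h => F (g * h)%g)).
Proof.
elim: u F => [|i u IH] F /=.
  by apply: eq_word_exp => h; rewrite mul1g.
apply: eq_avg => [|a _]; first exact: finite_level.
rewrite IH; apply: eq_word_exp => g; apply: eq_word_exp => h.
by rewrite mulgA.
Qed.

Lemma word_exp_idem i w F : word_exp (i :: i :: w) F = word_exp (i :: w) F.
Proof.
rewrite /= -[RHS](avg_cst _ (finite_level m i) (level_neq0 m i)).
apply: eq_avg => [|a ia]; first exact: finite_level.
rewrite -[RHS](avg_mull _ (finite_level m i) (level_subgroup m i) ia).
apply: eq_avg => [|b _]; first exact: finite_level.
by apply: eq_word_exp => g; rewrite mulgA.
Qed.

Lemma avg_section_exp (A : set (tree_aut m)) z w (F : tree_aut m -> seq letter -> R) :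
  avg A (fun a => section_exp m z w (F a)) = section_exp m z w (fun u => avg A (F^~ u)).
Proof.
elim: w z F => [|[] w IH] z F //=.
by rewrite -!IH /avg -!mulr_suml big_split/= -mulr_sumr; ring.
Qed.

Hypothesis m_ge2 : (2 <= m)%N.

Lemma sum_nonzero (z : bool -> R) :
  \sum_(x : 'I_m) z (x != 0%N :> nat) = z false + (m%:R - 1) * z true.
Proof.
case: m m_ge2 => // n n1; rewrite (bigD1 ord0)//=; congr (_ + _).
rewrite (eq_bigr (fun=> z true)); last first.
  by move=> x; rewrite -val_eqE/= => ->.
have -> : (n.+1%:R - 1 : R) = n%:R by rewrite -natr1 addrK.
by rewrite sumr_const cardC1 card_ord mulr_natl.
Qed.

(** Invariance under transpositions makes the left side independent of [x], and its sum over [x]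
    runs over a permuted alphabet. *)
Lemma avg_root_perm (h : 'I_m -> R) x :
  avg (level m qm) (fun a => h (root_perm a x)) = (\sum_y h y) / m%:R.
Proof.
have m0 := M_neq0 R m_ge2.
have H y : avg (level m qm) (fun a => h (root_perm a x)) =
    avg (level m qm) (fun a => h (root_perm a y)).
  have ty : level m qm (rooted (tperm y x)) by exists (tperm y x).
  rewrite -[RHS](avg_mull _ (finite_level m qm) (level_subgroup m qm) ty).
  apply: eq_avg => [|a _]; first exact: finite_level.
  by rewrite root_permM root_perm_rooted permM tpermL.
apply: (mulIf m0); rewrite divfK// mulr_natr.
have <- : \sum_(y : 'I_m) avg (level m qm) (fun a => h (root_perm a y)) =
    avg (level m qm) (fun a => h (root_perm a x)) *+ m.
  by rewrite (eq_bigr _ (fun y _ => esym (H y))) sumr_const card_ord.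
rewrite -avg_sum.
rewrite -[RHS](avg_cst _ (finite_level m qm) (level_neq0 m qm)).
apply: eq_avg => [|a _]; first exact: finite_level.
by rewrite [RHS](reindex_perm (root_perm a)).
Qed.

(** This justifies [section_exp]: at 0 an element of [level q0] or [level q1] reproduces itself, and
    at a nonzero letter its section is uniform one level down by [avg_sec_q0] and [avg_sec_q1]. *)
Lemma word_exp_sec w F x :
  word_exp w (fun g => F (sec g x)) =
  section_exp m (x != 0%N :> nat) w (fun u => word_exp u F).
Proof.
elim: w F x => [|i w IH] F x /=; first by rewrite sec1.
have fl := finite_level m.
case: i => /=.
- transitivity (avg (level m qm) (fun a =>
      section_exp m (root_perm a x != 0%N :> nat) w (fun u => word_exp u F))).
    apply: eq_avg => // _ [s ->].
    rewrite -IH; apply: eq_word_exp => g.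
    by rewrite secM sec_rooted mul1g.
  rewrite (avg_root_perm (fun y => section_exp m (y != 0%N :> nat) w (fun u => word_exp u F))).
  by rewrite (sum_nonzero (fun z => section_exp m z w (fun u => word_exp u F))).
- have [x0|x0] := eqVneq (x : nat) 0%N; rewrite -avg_section_exp.
    apply: eq_avg => // a ia.
    have [sa ra] := level_sec0 (i := q0) (fun=> ltac:(discriminate)) ia x0.
    have := IH (fun g => F (a * g)%g) x; rewrite x0/= => <-.
    by apply: eq_word_exp => g; rewrite secM sa ra.
  rewrite -(avg_sec_q0 (x := x)); last exact/eqP.
  (* [sec a x] and [root_perm a x] may be correlated, but what follows depends on [root_perm a x]
     only through its being nonzero, which is certain. *)
  apply: eq_avg => // a ia; have [_ r0 _] := level_q0_sub ia.
  have := IH (fun g => F (sec a x * g)%g) (root_perm a x).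
  rewrite fixes0_eq0// x0/= => <-.
  by apply: eq_word_exp => g; rewrite secM.
- have [x0|x0] := eqVneq (x : nat) 0%N; rewrite -avg_section_exp.
    apply: eq_avg => // a ia.
    have [sa ra] := level_sec0 (i := q1) (fun=> ltac:(discriminate)) ia x0.
    have := IH (fun g => F (a * g)%g) x; rewrite x0/= => <-.
    by apply: eq_word_exp => g; rewrite secM sa ra.
  rewrite -(avg_sec_q1 (x := x)); last exact/eqP.
  apply: eq_avg => // a ia; have [_ r0 _] := level_q1_sub ia.
  have := IH (fun g => F (sec a x * g)%g) x.
  rewrite x0/= => <-.
  by apply: eq_word_exp => g; rewrite secM r0 perm1.
Qed.

(** The constant comes from [prog_length_fix] used twice: over sections of length at most 1 for
    [q0], then of length at most [m + m + 1] for [q1]. *)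
Lemma level_computable i a : level m i a ->
  computable a /\ (prog_length a <= m * (m + m + 1) + m + 1)%N.
Proof.
have H0 b : level m qm b -> computable b /\ (prog_length b <= 1)%N.
  by move=> [s ->]; exact: prog_length_rooted.
have H1 b : level m q0 b -> computable b /\ (prog_length b <= m + m + 1)%N.
  move=> /level_q0_sub[b0 _ bs].
  have [|? le] := prog_length_fix b0; first by move=> x /bs/H0[].
  split=> //; apply: leq_trans le _; rewrite !leq_add2r.
  apply: (@leq_trans (\sum_(x : 'I_m) 1)%N); last by rewrite sum1_card card_ord.
  by rewrite big_mkcond; apply: leq_sum => x _; case: eqP => // /bs/H0[].
case: i => [/H0[? le]|/H1[? le]|/level_q1_sub[a0 _ as_]].
- by split=> //; apply: leq_trans le _; rewrite addn1.
- split=> //; apply: leq_trans le _.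
  by rewrite leq_add2r leq_add2r leq_pmulr// addn1.
- have [|? le] := prog_length_fix a0; first by move=> x /as_/H1[].
  split=> //; apply: leq_trans le _; rewrite !leq_add2r.
  apply: (@leq_trans (\sum_(x : 'I_m) (m + m + 1))%N); last by rewrite sum_nat_const card_ord.
  by rewrite big_mkcond; apply: leq_sum => x _; case: eqP => // /as_/H1[].
Qed.

Lemma reach_computable w g : reach w g -> computable g.
Proof.
elim: w g => [|i w IH] g /=.
  by move=> ->; rewrite -rooted1; exact: (prog_length_rooted _).1.
by move=> [a [h [/level_computable[ac _] /IH hc ->]]]; exact: (prog_lengthM ac hc).1.
Qed.

Lemma level_sec i a x : level m i a -> exists j, level m j (sec a x).
Proof.
move=> ia; have [x0|/eqP x0] := eqVneq (x : nat) 0%N.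
  case: i ia => [[s ->]|ia|ia].
  - by exists qm; rewrite sec_rooted; exact: (subgroup1 (level_subgroup m qm)).
  - by exists q0; have [-> _] := level_sec0 (i := q0) (fun=> ltac:(discriminate)) ia x0.
  - by exists q1; have [-> _] := level_sec0 (i := q1) (fun=> ltac:(discriminate)) ia x0.
case: i ia => [[s ->]|/level_q0_sub[_ _ H]|/level_q1_sub[_ _ H]].
- by exists qm; rewrite sec_rooted; exact: (subgroup1 (level_subgroup m qm)).
- by exists qm; exact: H.
- by exists q0; exact: H.
Qed.

Lemma reach_sec w g x : reach w g -> exists u, reach u (sec g x).
Proof.
elim: w g x => [|i w IH] g x /=; first by move=> ->; exists [::]; rewrite /= sec1.
move=> [a [h [ia /IH wh ->]]].
have [j ja] := level_sec x ia; have [u uh] := wh (root_perm a x).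
by exists (j :: u), (sec a x), (sec h (root_perm a x)); rewrite -secM.
Qed.

Lemma reach_self_similar0 w g : all (predC is_qm) w -> reach w g -> self_similar0 g.
Proof.
elim: w g => [|i w IH] g /=; first by move=> _ -> x _; rewrite sec1.
move=> /andP[iq wq] [a [h [ia /(IH _ wq) h0 ->]]] x x0.
have [|sa ra] := level_sec0 _ ia x0; first by case: i iq {ia}.
by rewrite secM sa ra h0.
Qed.

Definition word_cost w : R := word_exp w (fun g => (prog_length g)%:R).

Lemma section_exp_noqm w (Phi : seq letter -> R) : all (predC is_qm) w ->
  section_exp m true w Phi = Phi (map down w).
Proof. by elim: w Phi => [|[] w IH] Phi //= /IH ->. Qed.

Lemma word_cost_sublinear (eps : R) : 0 < eps ->
  exists e, forall w, word_cost w <= eps * (size w)%:R + e.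
Proof.
pose C0 := (m * (m + m + 1) + m + 1)%N.
have C1 : (1 <= C0)%N by rewrite /C0 addn1.
apply: (@cost_sublinear R m m_ge2 word_cost C0%:R).
- by [].
- rewrite /word_cost /= ler_nat -rooted1.
  exact: leq_trans (prog_length_rooted _).2 _.
- move=> i; rewrite -(avg_cst C0%:R (finite_level m i) (level_neq0 m i)).
  apply: le_avg => [|a /level_computable[_ le]]; first exact: finite_level.
  by rewrite /= mulg1 ler_nat.
- move=> u v; rewrite /word_cost word_exp_cat.
  apply: (@le_trans _ _ (word_exp u (fun g => word_exp v (fun h =>
     (prog_length g)%:R + ((prog_length h)%:R + 1))))).
    apply: le_word_exp => g /reach_computable gc; apply: le_word_exp => h /reach_computable hc.
    have [_ le] := prog_lengthM gc hc.
    by rewrite natr1 -natrD ler_nat addnS -addn1.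
  under eq_word_exp do rewrite word_expD word_exp_cst word_expD word_exp_cst.
  rewrite word_expD word_exp_cst -addrA lerD2l lerD2l.
  by rewrite ler1n.
- by move=> i w; exact: word_exp_idem.
- move=> w; rewrite addrC.
  apply: (@le_trans _ _ (word_exp w (fun g =>
      \sum_x (prog_length (sec g x))%:R + 1))).
    apply: le_word_exp => g gr; rewrite -natr_sum natr1 ler_nat -addn1.
    apply: (prog_length_sec _).2 => x.
    by have [u] := reach_sec x gr; exact: reach_computable.
  rewrite word_expD word_exp_cst word_exp_sum lerD ?ler1n//.
  under eq_bigr do rewrite (word_exp_sec w (fun g => (prog_length g)%:R)).
  by rewrite (sum_nonzero (fun z => section_exp m z w word_cost)).
- move=> w wq; rewrite addrC.
  apply: (@le_trans _ _ (word_exp w (fun g =>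
      \sum_(x : 'I_m | x != 0%N :> nat) (prog_length (sec g x))%:R + (m + 1)%:R))).
    apply: le_word_exp => g gr; rewrite -natr_sum -natrD ler_nat addnA.
    apply: (prog_length_fix (reach_self_similar0 wq gr) _).2 => x _.
    by have [u] := reach_sec x gr; exact: reach_computable.
  rewrite word_expD word_exp_cst word_exp_sum; apply: lerD; last first.
    by rewrite ler_nat /C0 -addnA leq_addl.
  under eq_bigr => x x0.
    rewrite (word_exp_sec w (fun g => (prog_length g)%:R)) x0 section_exp_noqm//; over.
  have := sum_nonzero (fun z : bool => if z then word_cost (map down w) else 0).
  by rewrite add0r => <-; rewrite [leLHS]big_mkcond.
Qed.

End WordExpectation.

(** * Discrete measures and entropy *)

Section EsumExtra.
Local Open Scope classical_set_scope.
Local Open Scope ring_scope.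
Local Open Scope ereal_scope.
Variable R : realType.

Lemma esum_exchange (S T : choiceType) (a : S -> T -> \bar R) :
  (forall i j, 0 <= a i j) ->
  \esum_(i in [set: S]) \esum_(j in [set: T]) a i j =
  \esum_(j in [set: T]) \esum_(i in [set: S]) a i j.
Proof.
move=> a0; rewrite !esum_esum//.
rewrite (reindex_esum ([set: T] `*`` (fun=> [set: S])) _ (fun p => (p.2, p.1)))//.
split=> [[i j] //|[i j] [i' j'] _ _ [-> ->] //|[i j] _].
by exists (j, i).
Qed.

Lemma esumZl (T : choiceType) (c : \bar R) (a : T -> \bar R) :
  0 <= c -> (forall i, 0 <= a i) ->
  \esum_(i in [set: T]) c * a i = c * \esum_(i in [set: T]) a i.
Proof.
move=> c0 a0; case: c c0 => [r|_|//].
- rewrite lee_fin le_eqVlt => /predU1P[<-|r0].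
    by rewrite mul0e esum1// => i _; rewrite mul0e.
  rewrite /esum -ereal_sup_pZl//; congr ereal_sup; apply/seteqP; split=> x /=.
    move=> [X XT <-]; exists (\sum_(i \in X) a i); first by exists X.
    by rewrite ge0_mule_fsumr.
  by move=> [_ [X XT <-] <-]; exists X => //; rewrite ge0_mule_fsumr.
have [[i ai]|/forallNP az] := pselect (exists i, a i != 0).
  have ai0 : 0 < a i by rewrite lt_def ai a0.
  rewrite gt0_mulye; last first.
    apply: lt_le_trans ai0 _; apply: esum_ge; exists [set i]; last by rewrite fsbig_set1.
    by split=> //; exact: finite_set1.
  apply/eqP; rewrite -leye_eq; apply: esum_ge; exists [set i].
    by split=> //; exact: finite_set1.
  by rewrite fsbig_set1 gt0_mulye.
have az' i : a i = 0 by apply/eqP/negPn/negP/az.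
by rewrite !esum1 ?mule0// => i _; rewrite az' mule0.
Qed.

End EsumExtra.

Section Integral.
Local Open Scope classical_set_scope.
Local Open Scope ring_scope.
Local Open Scope ereal_scope.
Variables (R : realType) (G : groupType).
Implicit Types (t : G -> R) (F : G -> \bar R) (g h : G).

Definition dint t F : \bar R := \esum_(g in [set: G]) ((t g)%:E * F g).

(** Mass at most 1 is enough for upper bounds on entropy and passes through convolutions and
    mixtures. *)
Definition sub_pmf t := (forall g, (0 <= t g)%R) /\ dint t (fun=> 1) <= 1.

Lemma dint_ge0 t F : (forall g, (0 <= t g)%R) -> (forall g, 0 <= F g) ->
  0 <= dint t F.
Proof. by move=> t0 F0; apply: esum_ge0 => g _; rewrite mule_ge0 ?lee_fin. Qed.

Lemma le_dint t F1 F2 : (forall g, (0 <= t g)%R) -> (forall g, F1 g <= F2 g) ->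
  dint t F1 <= dint t F2.
Proof. by move=> t0 F12; apply: le_esum => g _; rewrite lee_wpmul2l ?lee_fin. Qed.

Lemma eq_dint t F1 F2 : F1 =1 F2 -> dint t F1 = dint t F2.
Proof. by move=> /funext ->. Qed.

Lemma sub_pmf_le1 t g : sub_pmf t -> (t g <= 1)%R.
Proof.
move=> [t0 t1]; rewrite -lee_fin; apply: le_trans t1; apply: esum_ge.
exists [set g]; last by rewrite fsbig_set1 mule1.
by split=> //; exact: finite_set1.
Qed.

Lemma dint_mass a F : (forall g, 0 <= F g) -> dint (point_mass R a) F = F a.
Proof.
move=> F0; rewrite /dint (esumID [set a])//; last first.
  by move=> g _; rewrite mule_ge0// lee_fin.
rewrite setTI esum_set1 ?mule_ge0 ?lee_fin//.
rewrite /point_mass eqxx mul1e esum1 ?adde0// => g [_ /= /eqP/negPf ->].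
by rewrite mul0e.
Qed.

Lemma sub_pmf_mass a : sub_pmf (point_mass R a).
Proof. by split=> [g|]; [rewrite ler0n|rewrite dint_mass]. Qed.

Lemma convolutionE t1 t2 g : sub_pmf t1 -> sub_pmf t2 ->
  (convolution t1 t2 g)%:E = \esum_(h in [set: G]) (t1 h * t2 (h^-1 * g)%g)%:E.
Proof.
move=> t1P t2P; rewrite fineK// ge0_fin_numE; last first.
  by apply: esum_ge0 => h _; rewrite lee_fin mulr_ge0 ?t1P.1 ?t2P.1.
apply: (@le_lt_trans _ _ 1); last by rewrite ltry.
apply: le_trans t1P.2; apply: le_esum => h _.
by rewrite mule1 lee_fin ler_piMr ?t1P.1// sub_pmf_le1.
Qed.

Lemma dint_conv t1 t2 F : sub_pmf t1 -> sub_pmf t2 -> (forall g, 0 <= F g) ->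
  dint (convolution t1 t2) F =
  dint t1 (fun h => dint t2 (fun k => F (h * k)%g)).
Proof.
move=> t1P t2P F0; have [t10 _] := t1P; have [t20 _] := t2P.
transitivity (\esum_(g in [set: G]) \esum_(h in [set: G])
    ((t1 h)%:E * ((t2 (h^-1 * g)%g)%:E * F g))).
  apply: eq_esum => g _; rewrite convolutionE// muleC -esumZl//; last first.
    by move=> h; rewrite lee_fin mulr_ge0.
  by apply: eq_esum => h _; rewrite EFinM muleC -muleA.
rewrite esum_exchange; last by move=> g h; rewrite !mule_ge0 ?lee_fin.
apply: eq_esum => h _; rewrite esumZl ?lee_fin//; last first.
  by move=> g; rewrite mule_ge0 ?lee_fin.
congr (_ * _); rewrite (reindex_esum [set: G] _ (fun k => (h * k)%g)).
  by apply: eq_esum => k _; rewrite mulKg.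
split=> // [k k' _ _|k _]; first exact: mulgI.
by exists (h^-1 * k)%g; rewrite // mulgA mulgV mul1g.
Qed.

Lemma convolution_ge0 t1 t2 g : (forall g, (0 <= t1 g)%R) -> (forall g, (0 <= t2 g)%R) ->
  (0 <= convolution t1 t2 g)%R.
Proof.
by move=> t10 t20; apply: fine_ge0; apply: esum_ge0 => h _; rewrite lee_fin mulr_ge0.
Qed.

Lemma sub_pmf_conv t1 t2 : sub_pmf t1 -> sub_pmf t2 -> sub_pmf (convolution t1 t2).
Proof.
move=> t1P t2P; split=> [g|]; first by apply: convolution_ge0; [exact: t1P.1|exact: t2P.1].
rewrite dint_conv//; apply: le_trans t1P.2.
by apply: le_dint => [|g]; [exact: t1P.1|exact: t2P.2].
Qed.

Lemma conv_pow_sub_pmf t n : sub_pmf t -> sub_pmf (conv_pow t n).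
Proof.
move=> tP; elim: n => [|n IH]; first exact: sub_pmf_mass.
exact: sub_pmf_conv.
Qed.

Definition supported (S : set G) t := forall g, t g <> 0%R -> S g.

Lemma supported_conv (S : set G) t1 t2 : sub_pmf t1 -> sub_pmf t2 ->
  (forall g h, S g -> S h -> S (g * h)%g) ->
  supported S t1 -> supported S t2 -> supported S (convolution t1 t2).
Proof.
move=> t1P t2P SM S1 S2 g; apply: contra_notP => nS.
rewrite /convolution esum1// => h _; congr EFin.
have [->|/eqP/S1 Sh] := eqVneq (t1 h) 0%R; first by rewrite mul0r.
have [->|/eqP/S2 Sg] := eqVneq (t2 (h^-1 * g)%g) 0%R; first by rewrite mulr0.
by case: nS; rewrite -(mulVKg h g) ; exact: SM.
Qed.

Lemma supported_mass (S : set G) : S 1%g -> supported S (point_mass R 1%g).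
Proof. by move=> S1 g; rewrite /point_mass; case: eqP => [->|]. Qed.

Lemma uniform_dint (A : set G) (f : G -> R) : finite_set A ->
  (forall g, (0 <= f g)%R) ->
  dint (uniform_on R A) (EFin \o f) = (avg A f)%:E.
Proof.
move=> fA f0; rewrite /dint (esumID A)//; last first.
  by move=> g _; rewrite lee_fin mulr_ge0// divr_ge0// indicE ler0n.
rewrite setTI [X in _ + X]esum1 ?adde0; last first.
  by move=> g [_ /= nA]; rewrite /uniform_on indicE memNset// mul0r mul0e.
rewrite esum_fset//; last first.
  by move=> g _; rewrite lee_fin mulr_ge0// divr_ge0// indicE ler0n.
rewrite fsbig_finite//= /avg mulr_suml -sumEFin.
rewrite big_seq [RHS]big_seq; apply: eq_bigr => g; rewrite in_fset_set// => gA.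
by rewrite /uniform_on indicE gA -EFinM mul1r mulrC.
Qed.

Lemma uniform_sub_pmf (A : set G) : finite_set A -> A !=set0 ->
  sub_pmf (uniform_on R A).
Proof.
move=> fA A0; split=> [g|]; first by rewrite divr_ge0// indicE ler0n.
by rewrite (uniform_dint (f := fun=> 1%R))// avg_cst.
Qed.

Lemma supported_uniform (A : set G) : supported A (uniform_on R A).
Proof.
move=> g; rewrite /uniform_on indicE; case: (boolP (g \in A)); first by rewrite inE.
by rewrite mul0r.
Qed.

End Integral.

Section WordLaw.
Local Open Scope classical_set_scope.
Local Open Scope ring_scope.
Local Open Scope ereal_scope.
Variables (R : realType) (m : nat).
Implicit Types (u v w : seq letter) (f : tree_aut m -> R) (F : tree_aut m -> \bar R).

Definition word_law w : tree_aut m -> R :=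
  foldr (fun i t => convolution (uniform_on R (level m i)) t) (point_mass R 1%g) w.

Lemma unif_sub_pmf i : sub_pmf (uniform_on R (level m i)).
Proof. exact: uniform_sub_pmf (finite_level m i) (level_neq0 m i). Qed.

Lemma word_law_sub_pmf w : sub_pmf (word_law w).
Proof.
elim: w => [|i w IH]; first exact: sub_pmf_mass.
by apply: sub_pmf_conv => //; exact: unif_sub_pmf.
Qed.

Lemma word_exp_ge0 w f : (forall g, (0 <= f g)%R) -> (0 <= word_exp w f)%R.
Proof. by move=> f0; rewrite -[leLHS](@word_exp_cst R m w); apply: le_word_exp => g _. Qed.

Lemma dint_word_law w f : (forall g, (0 <= f g)%R) ->
  dint (word_law w) (EFin \o f) = (word_exp w f)%:E.
Proof.
elim: w f => [|i w IH] f f0 /=; first by rewrite dint_mass.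
rewrite dint_conv//; [|exact: unif_sub_pmf|exact: word_law_sub_pmf].
rewrite -uniform_dint//; last by move=> g; exact: word_exp_ge0.
  by apply: eq_dint => h; rewrite /= -IH.
exact: finite_level.
Qed.

Lemma dint_word_law_cat u v F : (forall g, 0 <= F g) ->
  dint (word_law (u ++ v)) F =
  dint (word_law u) (fun h => dint (word_law v) (fun k => F (h * k)%g)).
Proof.
have w0 w := (word_law_sub_pmf w).1.
elim: u F => [|i u IH] F F0 /=.
  rewrite dint_mass; last by move=> g; apply: dint_ge0.
  by apply: eq_dint => k; rewrite mul1g.
rewrite dint_conv//; [|exact: unif_sub_pmf|exact: word_law_sub_pmf].
rewrite dint_conv//; [|exact: unif_sub_pmf|exact: word_law_sub_pmf|]; last first.
  by move=> g; apply: dint_ge0.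
apply: eq_dint => h; rewrite IH//; apply: eq_dint => k; apply: eq_dint => l.
by rewrite mulgA.
Qed.

(** Transfers identities between expectations, such as [word_exp_idem], to the laws themselves. *)
Lemma word_lawE w g : word_law w g = word_exp w (fun h => (h == g)%:R).
Proof.
apply: EFin_inj; rewrite -dint_word_law; last by move=> h; rewrite ler0n.
rewrite /dint (esumID [set g])//; last first.
  by move=> h _; rewrite lee_fin mulr_ge0// (word_law_sub_pmf w).1.
rewrite setTI esum_set1; last by rewrite lee_fin mulr_ge0// (word_law_sub_pmf w).1.
rewrite /= eqxx mule1 esum1 ?adde0// => h [_ /= /eqP/negPf ->].
by rewrite mule0.
Qed.

Definition letter_of (i : option 'I_2) : letter :=
  if i is Some j then if val j == 0%N then q0 else q1 else qm.

Lemma level_index_letter_of i : level_index (letter_of i) = omap val i.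
Proof. by case: i => [[[|[|//]] ?]|]. Qed.

Lemma word_exp_pattern_cong (p q : seq (option 'I_2)) f : pattern_cong p q ->
  word_exp (map letter_of p) f = word_exp (map letter_of q) f.
Proof.
move=> H; elim: H f => [i|u|u v _ IH|u v w _ IH1 _ IH2|u u' v v' _ IH1 _ IH2] f //.
- exact: word_exp_idem.
- by rewrite IH1 IH2.
- by rewrite !map_cat !word_exp_cat IH1; apply: eq_word_exp => g; rewrite IH2.
Qed.

(* [pattern_bar] uses [repr p], which need not be a shortest word for [p]. *)
Lemma short_word (p : pattern 1) :
  exists w, size w = pattern_len p /\ pattern_bar R p = word_law w.
Proof.
have E : pattern_bar R (m := m) p = word_law (map letter_of (repr p)).
  rewrite /pattern_bar /word_law; elim: (repr p) => //= i r ->.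
  by rewrite /level level_index_letter_of.
rewrite /pattern_len; case: ex_minnP => n /asboolP[u [un up]] _.
exists (map letter_of u); rewrite size_map; split=> //; rewrite E.
apply/funext => g; rewrite !word_lawE; apply: word_exp_pattern_cong.
by apply/pat_eqP; rewrite pat_repr.
Qed.

End WordLaw.

Section Mixture.
Local Open Scope classical_set_scope.
Local Open Scope ring_scope.
Local Open Scope ereal_scope.
Variables (R : realType) (m : nat) (mu : pattern 1 -> R).
Hypothesis mu_pmf : is_pmf mu.
Implicit Types (F : tree_aut m -> \bar R).

Let pb_pmf p : sub_pmf (@pattern_bar R m 1 p).
Proof. by have [w [_ ->]] := short_word R m p; exact: word_law_sub_pmf. Qed.

Lemma mixtureE g : (@mixture_bar R m 1 mu g)%:E =
  \esum_(p in [set: pattern 1]) ((mu p)%:E * (pattern_bar R p g)%:E).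
Proof.
have [mu0 mu1] := mu_pmf.
rewrite fineK// ge0_fin_numE; last first.
  by apply: esum_ge0 => p _; rewrite lee_fin mulr_ge0 ?mu0 ?(pb_pmf p).1.
apply: (@le_lt_trans _ _ 1); last by rewrite ltry.
rewrite -mu1; apply: le_esum => p _.
by rewrite lee_fin ler_piMr ?mu0// sub_pmf_le1.
Qed.

Lemma dint_mixture F : (forall g, 0 <= F g) ->
  dint (@mixture_bar R m 1 mu) F =
  \esum_(p in [set: pattern 1]) ((mu p)%:E * dint (pattern_bar R p) F).
Proof.
move=> F0; have [mu0 mu1] := mu_pmf.
have b0 p g : (0 <= @pattern_bar R m 1 p g)%R by exact: (pb_pmf p).1.
transitivity (\esum_(g in [set: tree_aut m]) \esum_(p in [set: pattern 1])
    ((mu p)%:E * ((pattern_bar R p g)%:E * F g))).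
  apply: eq_esum => g _; rewrite mixtureE muleC -esumZl//; last first.
    by move=> p; rewrite mule_ge0 ?lee_fin.
  by apply: eq_esum => p _; rewrite muleC -muleA.
rewrite esum_exchange; last by move=> g p; rewrite !mule_ge0 ?lee_fin.
apply: eq_esum => p _; rewrite esumZl ?lee_fin// => g.
by rewrite mule_ge0 ?lee_fin.
Qed.

Lemma mixture_sub_pmf : sub_pmf (@mixture_bar R m 1 mu).
Proof.
have [mu0 mu1] := mu_pmf.
split=> [g|].
  rewrite /mixture_bar; apply: fine_ge0; apply: esum_ge0 => p _.
  by rewrite lee_fin mulr_ge0 ?(pb_pmf p).1.
rewrite dint_mixture// -[leRHS]mu1; apply: le_esum => p _.
by rewrite -[leRHS]mule1; apply: lee_wpmul2l; [rewrite lee_fin|exact: (pb_pmf p).2].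
Qed.

Lemma supported_word_law (S : set (tree_aut m)) w : S 1%g ->
  (forall g h, S g -> S h -> S (g * h)%g) -> (forall i, level m i `<=` S) ->
  supported S (@word_law R m w).
Proof.
move=> S1 SM Slev; elim: w => [|i w IH]; first exact: supported_mass.
apply: supported_conv => //; [exact: unif_sub_pmf|exact: word_law_sub_pmf|].
by move=> g /supported_uniform; exact: Slev.
Qed.

Lemma supported_mixture (S : set (tree_aut m)) : S 1%g ->
  (forall g h, S g -> S h -> S (g * h)%g) -> (forall i, level m i `<=` S) ->
  supported S (@mixture_bar R m 1 mu).
Proof.
move=> S1 SM Slev g; apply: contra_notP => nS.
rewrite /mixture_bar esum1// => p _; congr EFin.
have [w [_ ->]] := short_word R m p.
have [->|/eqP/(supported_word_law S1 SM Slev)//] := eqVneq (@word_law R m w g) 0%R.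
by rewrite mulr0.
Qed.

Lemma supported_conv_pow (S : set (tree_aut m)) n : S 1%g ->
  (forall g h, S g -> S h -> S (g * h)%g) -> (forall i, level m i `<=` S) ->
  supported S (conv_pow (@mixture_bar R m 1 mu) n).
Proof.
move=> S1 SM Slev; elim: n => [|n IH]; first exact: supported_mass.
apply: supported_conv => //; [exact: mixture_sub_pmf| |exact: supported_mixture].
exact/conv_pow_sub_pmf/mixture_sub_pmf.
Qed.

Variable lam : R.
Hypothesis mu_mean : mean_length mu = lam%:E.
Variables (c : tree_aut m -> R) (eps e : R).
Hypotheses (c_ge0 : forall g, (0 <= c g)%R) (eps_ge0 : (0 <= eps)%R) (e_ge0 : (0 <= e)%R).
Hypothesis word_exp_le : forall w, (word_exp w c <= eps * (size w)%:R + e)%R.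

(** [w] accumulates the steps already drawn. Drawing a pattern appends a shortest word for it, of
    mean length [lam]; once all are drawn the bound for a single word applies, with an [e] common to
    all words. *)
Lemma mean_conv_pow n w :
  dint (@word_law R m w) (fun h =>
    dint (conv_pow (@mixture_bar R m 1 mu) n) (fun g => (c (h * g)%g)%:E)) <=
  (eps * ((size w)%:R + n%:R * lam) + e)%:E.
Proof.
have [mu0 mu1] := mu_pmf.
have lam0 : (0 <= lam)%R.
  by rewrite -lee_fin -mu_mean; apply: esum_ge0 => p _; rewrite lee_fin mulr_ge0.
have mix := mixture_sub_pmf.
have w0 u := (@word_law_sub_pmf R m u).1.
have p0 p := (pb_pmf p).1.
elim: n w => [|n IH] w.
  under eq_dint => h do (rewrite dint_mass; last by move=> g; rewrite lee_fin c_ge0).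
  rewrite (eq_dint _ (F2 := EFin \o c)); last by move=> h; rewrite /= mulg1.
  by rewrite dint_word_law// lee_fin mul0r addr0.
pose Phi (h : tree_aut m) :=
  dint (conv_pow (@mixture_bar R m 1 mu) n) (fun g => (c (h * g)%g)%:E).
have mn := conv_pow_sub_pmf n mix.
have Phi0 h : 0 <= Phi h by apply: dint_ge0 => [g|g]; [exact: mn.1|rewrite lee_fin].
have -> : dint (@word_law R m w) (fun h =>
    dint (conv_pow (@mixture_bar R m 1 mu) n.+1) (fun g => (c (h * g)%g)%:E)) =
    \esum_(p in [set: pattern 1]) ((mu p)%:E *
      dint (@word_law R m w) (fun h => dint (pattern_bar R p) (fun k => Phi (h * k)%g))).
  transitivity (\esum_(h in [set: tree_aut m]) \esum_(p in [set: pattern 1])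
     ((mu p)%:E * ((word_law R w h)%:E * dint (pattern_bar R p) (fun k => Phi (h * k)%g)))).
    apply: eq_esum => h _.
    rewrite [conv_pow _ _]/= dint_conv//; last by move=> g; rewrite lee_fin.
    rewrite (eq_dint _ (F2 := fun k => Phi (h * k)%g)); last first.
      by move=> k; apply: eq_dint => g; rewrite mulgA.
    rewrite dint_mixture// -esumZl ?lee_fin//; last first.
      by move=> p; rewrite mule_ge0 ?lee_fin// dint_ge0.
    by apply: eq_esum => p _; rewrite muleCA.
  rewrite esum_exchange; last by move=> h p; rewrite !mule_ge0 ?lee_fin// dint_ge0.
  apply: eq_esum => p _; rewrite esumZl ?lee_fin// => h.
  by rewrite mule_ge0 ?lee_fin// dint_ge0.
apply: (@le_trans _ _ (\esum_(p in [set: pattern 1])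
    ((eps * ((size w)%:R + n%:R * lam) + e)%:E * (mu p)%:E +
     eps%:E * (mu p * (pattern_len p)%:R)%:E))).
  apply: le_esum => p _; have [v [vp ->]] := short_word R m p.
  rewrite -dint_word_law_cat//.
  have := IH (w ++ v); rewrite size_cat vp => le.
  apply: le_trans (lee_wpmul2l _ le) _; first by rewrite lee_fin.
  by rewrite -!EFinM -EFinD lee_fin natrD; lra.
have A0 : (0 <= eps * ((size w)%:R + n%:R * lam) + e)%R.
  by rewrite addr_ge0// mulr_ge0// addr_ge0// mulr_ge0.
rewrite esumD; last 2 first.
- by move=> p _; rewrite mule_ge0 ?lee_fin.
- by move=> p _; rewrite mule_ge0 ?lee_fin ?mulr_ge0.
rewrite !esumZl ?lee_fin//; last first.
- by move=> p; rewrite lee_fin mulr_ge0.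
have -> : \esum_(p in [set: pattern 1]) (mu p * (pattern_len p)%:R)%:E = lam%:E by exact: mu_mean.
by rewrite mu1 -!EFinM -EFinD lee_fin -natr1; lra.
Qed.

End Mixture.

(** * Entropy bounded by mean program length *)

Section EntropyBound.
Local Open Scope classical_set_scope.
Local Open Scope ring_scope.
Local Open Scope ereal_scope.
Variables (R : realType) (m : nat).

Definition code_weight : R := ((#|{: op m}|)%:R * 2)^-1%R.
Local Notation x := code_weight.

Let x_gt0 : (0 < x)%R.
Proof.
rewrite /code_weight invr_gt0 mulr_gt0// ltr0n; apply/card_gt0P.
by exists (Mul m).
Qed.

Let x_le1 : (x <= 1)%R.
Proof.
rewrite /code_weight invf_le1; last by rewrite -invr_gt0.
rewrite -natrM ler1n muln_gt0 andbT.
by apply/card_gt0P; exists (Mul m).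
Qed.

(** Shortest programs of distinct elements are distinct, so [kraft_words] applies to them. *)
Lemma esum_prog_length :
  \esum_(g in [set: tree_aut m])
    (if `[< computable g >] then x ^+ prog_length g else 0%R)%:E <= 2%:E.
Proof.
apply: ge_ereal_sup => _ [X [fX _] <-].
rewrite fsbig_finite//= sumEFin lee_fin -big_mkcond/= -big_filter.
pose P (g : tree_aut m) :=
  if pselect (computable g) is left gc then s2val (cid2 (prog_lengthP gc))
  else [::].
have PP g : computable g -> computes (P g) g /\ size (P g) = prog_length g.
  by move=> gc; rewrite /P; case: pselect => // gc'; case: cid2.
set r := [seq _ <- _ | _].
have rc g : g \in r -> computable g by rewrite mem_filter => /andP[/asboolP].
have -> : (\sum_(g <- r) x ^+ prog_length g = \sum_(p <- map P r) x ^+ size p)%R.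
  rewrite big_map big_seq [RHS]big_seq; apply: eq_bigr => g /rc/PP[_ ->] //.
apply: kraft_words; first exact: ltW.
  rewrite -mulrA /x mulVf// mulf_neq0// pnatr_eq0 -lt0n.
  by apply/card_gt0P; exists (Mul m).
rewrite map_inj_in_uniq ?filter_uniq ?fset_uniq// => g h /rc/PP[Pg _] /rc/PP[Ph _] gh.
by rewrite gh in Pg; exact: computes_inj Pg Ph.
Qed.

Lemma entropy_ge0 (t : tree_aut m -> R) : sub_pmf t -> 0 <= entropy t.
Proof.
move=> tP; apply: esum_ge0 => g _; rewrite lee_fin oppr_ge0 mulr_ge0_le0 ?tP.1//.
exact/ln_le0/sub_pmf_le1.
Qed.

Lemma code_rate_ge0 : (0 <= - ln x)%R.
Proof. by rewrite oppr_ge0 ln_le0. Qed.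

(** Pointwise Gibbs inequality, from [ln (y / s) <= y / s - 1]. Keeping [y] instead of [y - s]
    leaves a sum of nonnegative weights, of total at most 2 for the code weights. *)
Lemma gibbs (s y : R) : (0 <= s)%R -> (0 < y)%R -> (- (s * ln s) <= s * - ln y + y)%R.
Proof.
rewrite le_eqVlt => /predU1P[<-|s0] y0; first by rewrite !mul0r oppr0 add0r ltW.
have ys : (-1 < y / s - 1)%R by rewrite ltrBrDl addrN divr_gt0.
have := le_ln1Dx ys; rewrite addrCA subrr addr0 ln_div ?posrE// => /(ler_wpM2l (ltW s0)).
rewrite !mulrBr (mulrC s (y / s)%R) divfK ?gt_eqF//; lra.
Qed.

Lemma entropy_le (t : tree_aut m -> R) : sub_pmf t ->
  supported [set g | computable g] t ->
  entropy t <= (- ln x)%:E * dint t (fun g => (prog_length g)%:R%:E) + 2%:E.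
Proof.
move=> tP ts; have lx := code_rate_ge0.
apply: le_trans (leeD2l _ esum_prog_length).
rewrite -esumZl ?lee_fin//; last by move=> g; rewrite lee_fin mulr_ge0// tP.1.
rewrite -esumD; last 2 first.
- by move=> g _; rewrite lee_fin !mulr_ge0// tP.1.
- by move=> g _; rewrite lee_fin; case: ifP => // _; rewrite exprn_ge0// ltW.
apply: le_esum => g _; rewrite -!EFinM -EFinD lee_fin.
case: ifPn => [_|/asboolPn nc]; last first.
  have -> : t g = 0%R by apply: contra_notP nc => /ts.
  by rewrite !mul0r oppr0 mulr0 addr0.
apply: le_trans (gibbs (tP.1 g) (exprn_gt0 (prog_length g) x_gt0)) _.
by rewrite lerD2r lnXn// -mulr_natr; lra.
Qed.

End EntropyBound.

Section ZeroEntropy.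
Local Open Scope classical_set_scope.
Local Open Scope ring_scope.
Local Open Scope ereal_scope.
Variables (R : realType) (m : nat) (mu : pattern 1 -> R).
Hypotheses (m_ge2 : (2 <= m)%N) (mu_pmf : is_pmf mu).
Hypothesis mu_mean : mean_length mu < +oo.
Local Notation t := (@mixture_bar R m 1 mu).

Let t_pmf n : sub_pmf (conv_pow t n).
Proof. exact/conv_pow_sub_pmf/mixture_sub_pmf. Qed.

Let t_computable n : supported [set g | computable g] (conv_pow t n).
Proof.
apply: supported_conv_pow => //=.
- by rewrite -rooted1; exact: (prog_length_rooted _).1.
- by move=> g h gc hc; exact: (prog_lengthM gc hc).1.
- by move=> i a /level_computable[].
Qed.

Lemma entropy_conv_pow_le (eps : R) : (0 < eps)%R -> exists C : R,
  forall n, entropy (conv_pow t n) <= (eps * n%:R + C)%:E.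
Proof.
move=> eps0; have [mu0 _] := mu_pmf.
have mean0 : 0 <= mean_length mu by apply: esum_ge0 => p _; rewrite lee_fin mulr_ge0.
have meanE : mean_length mu = (fine (mean_length mu))%:E.
  by rewrite fineK// ge0_fin_numE.
set lam := fine _ in meanE.
have lam0 : (0 <= lam)%R by rewrite fine_ge0.
pose A : R := (- ln (code_weight R m))%R.
have A0 : (0 <= A)%R := code_rate_ge0 R m.
(* Chosen so that [d * (A * lam) <= eps]; the [+ 1] covers the case [A * lam = 0]. *)
pose d : R := (eps / (A * lam + 1))%R.
have Al : (0 < A * lam + 1)%R by rewrite ltr_wpDl// mulr_ge0.
have d0 : (0 < d)%R by rewrite divr_gt0.
have [e He] := word_cost_sublinear m_ge2 d0.
exists (A * `|e| + 2)%R => n.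
apply: le_trans (entropy_le (t_pmf n) (@t_computable n)) _.
have c0 (g : tree_aut m) : (0 <= (prog_length g)%:R :> R)%R by [].
have He' w : (word_exp w (fun g : tree_aut m => (prog_length g)%:R) <=
    d * (size w)%:R + `|e|)%R.
  by apply: le_trans (He w) _; rewrite lerD2l ler_norm.
(* The law of the empty word is the point mass at 1, so the outer integral disappears. *)
have := mean_conv_pow mu_pmf meanE c0 (ltW d0) (normr_ge0 e) He' n [::].
rewrite /= dint_mass; last first.
  by move=> g; apply: dint_ge0 => [h|h]; [exact: (t_pmf n).1|rewrite lee_fin].
rewrite (eq_dint _ (F2 := fun g => (prog_length g)%:R%:E)); last by move=> g; rewrite mul1g.
rewrite add0r => /(lee_wpmul2l (_ : 0 <= A%:E)) le.
apply: (@le_trans _ _ (A%:E * (d * (n%:R * lam) + `|e|)%:E + 2%:E)).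
  by rewrite leeD2r// le// lee_fin.
rewrite -EFinM -EFinD lee_fin.
have : (d * (A * lam) <= eps)%R.
  by rewrite /d mulrAC ler_pdivrMr// ler_pM2l// lerDl.
by move=> /(ler_wpM2r (ler0n R n)); lra.
Qed.

Lemma mixture_entropy0 : has_asymptotic_entropy t 0.
Proof.
have ent0 n : 0 <= (n%:R^-1)%:E * entropy (conv_pow t n).
  by rewrite mule_ge0 ?lee_fin ?invr_ge0// entropy_ge0.
have small (eps : R) : (0 < eps)%R ->
    \forall n \near \oo, (n%:R^-1)%:E * entropy (conv_pow t n) <= eps%:E.
  move=> eps0; have e2 : (0 < eps / 2)%R by rewrite divr_gt0.
  have [C HC] := entropy_conv_pow_le e2.
  near=> n.
  have n0 : (0 < n%:R :> R)%R by near: n; exact: nbhs_infty_gtr.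
  apply: (@le_trans _ _ ((n%:R^-1)%:E * (eps / 2 * n%:R + C)%:E)).
    by rewrite lee_wpmul2l ?lee_fin ?invr_ge0.
  rewrite -EFinM lee_fin mulrC ler_pdivrMr//.
  have : (C / (eps / 2) < n%:R)%R by near: n; exact: nbhs_infty_gtr.
  by rewrite ltr_pdivrMr//; lra.
have fin (eps : R) n : (n%:R^-1)%:E * entropy (conv_pow t n) <= eps%:E ->
    (n%:R^-1)%:E * entropy (conv_pow t n) \is a fin_num.
  by move=> le; rewrite ge0_fin_numE//; apply: le_lt_trans le (ltry _).
rewrite /has_asymptotic_entropy; apply/fine_cvgP; split.
  by have := small 1%R ltr01; apply: filterS => n; exact: fin.
apply/cvgr0Pnorm_lt => eps eps0.
have e2 : (0 < eps / 2)%R by rewrite divr_gt0.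
have := small _ e2; apply: filterS => n len.
rewrite /= ger0_norm ?fine_ge0//.
rewrite -lte_fin fineK//; last exact: fin len.
by apply: le_lt_trans len _; rewrite lte_fin; lra.
Unshelve. all: by end_near.
Qed.

Lemma mixture_mother : supported (mother_group m 1) t.
Proof.
have sM := mother_subgroup m.
apply: (supported_mixture (subgroup1 sM)) => [g h|i].
- exact: (subgroupM sM).
- exact: level_mother.
Qed.

End ZeroEntropy.

Theorem theorem9p4 (R : realType) (m : nat) (hm : (2 <= m)%N)
  (mu : pattern 1 -> R) (mu_pmf : is_pmf mu)
  (mu_supp : forall p : pattern 1, mu p <> 0%R ->
     subpatterns 0 1 p \/ p = pat [:: Some ord_max])
  (mu_mean : (mean_length mu < +oo)%E) :
  (forall g : tree_aut m, mixture_bar mu g <> 0%R -> mother_group m 1 g) /\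
  has_asymptotic_entropy (@mixture_bar R m 1 mu) 0%E.
Proof. by split; [exact: mixture_mother|exact: mixture_entropy0]. Qed.
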